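(* Let $G$ be a finite simple graph with $n$ vertices such that $\operatorname{ht}(I(G))\geq 3$. Then $$\operatorname{reg}(I(G)^{\{3\}})\leq\min\Big\{\Big\lfloor\frac{n}{2}\Big\rfloor+3,\ \operatorname{reg}(I(G))+4\Big\}.$$
   Context: Let $\mathbb{K}$ be a field and let $G$ be a finite simple graph with vertex set $\{x_1,\ldots,x_n\}$; vertices are identified with the variables of $S=\mathbb{K}[x_1,\ldots,x_n]$. The edge ideal is $I(G)=(x_ix_j : x_ix_j\in E(G))\subseteq S$; its height $\operatorname{ht}(I(G))$ equals the smallest cardinality of a vertex cover of $G$. For a squarefree monomial ideal $I$ with irredundant primary decomposition $I=\mathfrak{p}_1\cap\cdots\cap\mathfrak{p}_r$ (each $\mathfrak{p}_i$ generated by variables), the $s$-th symbolic power ($s\ge 1$) is $I^{(s)}=\mathfrak{p}_1^s\cap\cdots\cap\mathfrak{p}_r^s$. The squarefree part of a monomial ideal is the ideal generated by all squarefree monomials in it; $I^{\{s\}}$ denotes the squarefree part of $I^{(s)}$. For a graded $S$-module $M$ with graded Betti numbers $\beta_{i,j}(M)$, $\operatorname{reg}(M)=\max\{j-i : \beta_{i,j}(M)\neq 0\}$ (ideals are regarded as graded $S$-modules). *)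

(* Defs.v *)
From mathcomp Require Import all_boot all_order all_algebra.
From mathcomp Require Import mpoly.

Set Implicit Arguments.
Unset Strict Implicit.
Unset Printing Implicit Defensive.

Import Order.TTheory GRing.Theory Num.Theory.
Local Open Scope ring_scope.

Section Ideals.
Variable R : comNzRingType.
Implicit Types I J P : R -> Prop.

Definition sub_ideal I J : Prop := forall p, I p -> J p.
Definition eq_ideal I J : Prop := forall p, I p <-> J p.

Definition is_ideal I : Prop :=
  [/\ I 0, forall p q, I p -> I q -> I (p + q) & forall a p, I p -> I (a * p)].

Definition is_prime_ideal P : Prop :=
  [/\ is_ideal P, ~ P 1 & forall p q, P (p * q) -> P p \/ P q].

Definition ideal_gen (A : R -> Prop) : R -> Prop := fun p =>
  exists (k : nat) (a g : 'I_k -> R),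
    (forall i, A (g i)) /\ p = \sum_(i < k) a i * g i.

Definition ideal_pow I (s : nat) : R -> Prop :=
  ideal_gen (fun p => exists g : 'I_s -> R,
    (forall i, I (g i)) /\ p = \prod_(i < s) g i).

(* [l <= ht P]: there are primes Q 0 < Q 1 < ... < Q l = P. *)
Definition prime_height_geq P (l : nat) : Prop :=
  exists Q : nat -> R -> Prop,
    [/\ forall k, (k <= l)%N -> is_prime_ideal (Q k),
        forall k, (k < l)%N -> sub_ideal (Q k) (Q k.+1) /\ ~ sub_ideal (Q k.+1) (Q k)
      & eq_ideal (Q l) P].

(* [l <= ht I], where ht I is the minimum of ht P over the primes P containing I. *)
Definition height_geq I (l : nat) : Prop :=
  forall P, is_prime_ideal P -> sub_ideal I P -> prime_height_geq P l.

End Ideals.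

Section Monomial.
Variables (K : fieldType) (n : nat).
Implicit Types I : {mpoly K[n]} -> Prop.

Definition edge_ideal (e : rel 'I_n) : {mpoly K[n]} -> Prop :=
  ideal_gen (fun p => exists i j, e i j /\ p = 'X_i * 'X_j).

Definition var_ideal (C : {set 'I_n}) : {mpoly K[n]} -> Prop :=
  ideal_gen (fun p => exists2 i, i \in C & p = 'X_i).

Definition var_meet (P : {set {set 'I_n}}) : {mpoly K[n]} -> Prop :=
  fun p => forall C, C \in P -> var_ideal C p.

Definition irredundant_decomp I (P : {set {set 'I_n}}) : Prop :=
  eq_ideal I (var_meet P) /\
  forall C, C \in P -> ~ eq_ideal I (var_meet (P :\ C)).

(* Meant for squarefree monomial ideals, for which the irredundant
   decomposition P exists and is unique. *)
Definition symbolic_power I (s : nat) : {mpoly K[n]} -> Prop := fun p =>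
  exists2 P, irredundant_decomp I P &
    forall C, C \in P -> ideal_pow (var_ideal C) s p.

Definition squarefree_part I : {mpoly K[n]} -> Prop :=
  ideal_gen (fun p => exists m : 'X_{1..n},
    [/\ forall i, (m i <= 1)%N, I 'X_[m] & p = 'X_[m]]).

End Monomial.

Arguments edge_ideal K {n} e p.

Section Regularity.
Variables (K : fieldType) (n : nat).
Local Notation S := {mpoly K[n]}.

(* A minimal graded free resolution
     ... -> F_2 -> F_1 -> F_0 -> I -> 0,   F_i = \bigoplus_(a < mfr_rank i) S(- mfr_deg i a),
   of an ideal I. Elements of F_i are row vectors and maps are right
   multiplications by matrices. Shifts may be taken in nat, since I lives in
   nonnegative degrees. Minimality says that the entries of the matrices lie in
   the ideal ('X_0, ..., 'X_(n-1)). *)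
Record min_free_res (I : S -> Prop) := MinFreeRes {
  mfr_rank : nat -> nat;
  mfr_deg : forall i, 'I_(mfr_rank i) -> nat;
  mfr_aug : 'cV[S]_(mfr_rank 0);
  mfr_diff : forall i, 'M[S]_(mfr_rank i.+1, mfr_rank i);
  mfr_aug_homog : forall a,
    {in msupp (mfr_aug a 0), forall m, mdeg m = mfr_deg a};
  mfr_diff_homog : forall i a b,
    {in msupp (mfr_diff i a b), forall m, (mdeg m + mfr_deg b)%N = mfr_deg a};
  mfr_aug_image : forall p, I p <-> exists v : 'rV_(mfr_rank 0), v *m mfr_aug = p%:M;
  mfr_exact0 : forall v : 'rV_(mfr_rank 0),
    v *m mfr_aug = 0 <-> exists w, v = w *m mfr_diff 0;
  mfr_exactS : forall i (v : 'rV_(mfr_rank i.+1)),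
    v *m mfr_diff i = 0 <-> exists w, v = w *m mfr_diff i.+1;
  mfr_minimal : forall i a b, (mfr_diff i a b)@_0%MM = 0
}.

Definition res_betti (I : S -> Prop) (F : min_free_res I) (i j : nat) : nat :=
  #|[set a : 'I_(mfr_rank F i) | mfr_deg a == j]|.

(* [beta i j] is the graded Betti number beta_{i,j}(I); minimal graded free
   resolutions exist and are unique up to isomorphism. *)
Definition graded_betti (I : S -> Prop) (beta : nat -> nat -> nat) : Prop :=
  exists F : min_free_res I, forall i j, beta i j = res_betti F i j.

(* r = reg I = max {j - i : beta_{i,j}(I) != 0}. *)
Definition is_reg (I : S -> Prop) (r : int) : Prop :=
  exists beta, [/\ graded_betti I beta,
    exists i j, beta i j <> 0%N /\ j%:Z - i%:Z = r
    & forall i j, beta i j <> 0%N -> j%:Z - i%:Z <= r].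

End Regularity.

(* Main.v *)
Require Import Defs.
From mathcomp Require Import all_boot all_order all_algebra zify.
From mathcomp Require Import mpoly.

Set Implicit Arguments.
Unset Strict Implicit.
Unset Printing Implicit Defensive.

Import Order.TTheory GRing.Theory Num.Theory.
Local Open Scope ring_scope.

(** The Koszul homology of a monomial ideal splits into multigraded strands, so
    both regularities become vanishing statements for the cohomology of the
    restricted Stanley-Reisner complexes. For I(G) these are the independence
    complexes Ind(W); for I(G)^{3} the faces are the sets that become independent
    after the removal of at most two vertices.

    Sort the faces F of the latter complex by the first edge l inside F, and then
    by the first edge l' inside F \ l. The pieces obtained are Ind(W), complexes
    Ind(Z) shifted by |l| = 2, and, shifted by 4, the complexes of independent sets
    R such that R + p + q is independent for some p in l and q in l'. By a Helly
    argument such a third-level complex is the independence complex of an auxiliary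
    graph, and cohomology of independence complexes vanishes in sizes larger than
    half of the number of vertices: this gives n/2 + 3. It is also a union of four
    complexes Ind(Z); the cohomology needed for Mayer-Vietoris in the intersections
    is controlled because Ind(Z + u + v) is the suspension of Ind(Z) when uv is an
    edge with no neighbour in Z: this gives reg I(G) + 4. *)

(** * Koszul differentials and cochains on families of sets *)

Section Kos.
Variables (n : nat) (R : comNzRingType) (V : lmodType R).
Implicit Types (u v : 'I_n) (A B C : {set 'I_n}) (x : 'I_n -> R).
Implicit Types (f g : {set 'I_n} -> V).

Definition eps v B : R := (-1) ^+ #|[set u in B | (u < v)%N]|.

(** For [x] constantly [1] this is the simplicial coboundary; for [x v = 'X_v] it is the Koszul
    differential, with [f A] the coefficient of the exterior monomial on the complement of [A]. A
    general [x] gives [d d = 0] once for both. *)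
Definition kos x f B : V := \sum_(v in B) (eps v (B :\ v) * x v) *: f (B :\ v).

Lemma epsU1 u v C : v \notin C -> eps u (v |: C) = (-1) ^+ (v < u)%N * eps u C.
Proof.
move=> vC; rewrite /eps -exprD; congr (_ ^+ _).
rewrite (cardsD1 v) !inE eqxx /=; congr (_ + _)%N.
by apply: eq_card => w; rewrite !inE; case: eqP => // ->; rewrite (negPf vC).
Qed.

Lemma epsM v C : eps v C * eps v C = 1.
Proof. by rewrite -expr2 sqrr_sign. Qed.

Lemma eps_swap u v C : u != v -> u \notin C -> v \notin C ->
  eps u (v |: C) * eps v C = - (eps v (u |: C) * eps u C).
Proof.
move=> uv uC vC; rewrite !epsU1 // -!mulrA [eps v C * _]mulrC -mulNr.
congr (_ * _); move: uv; rewrite -val_eqE /=.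
by case: ltngtP; rewrite ?expr0 ?expr1 ?opprK.
Qed.

(** The terms with [v < u] are paired with those with [u < v]. Showing only that the sum is its own
    opposite would fail in characteristic two. *)
Lemma antisym_sum (F : 'I_n -> 'I_n -> V) B :
  (forall u v, u \in B -> v \in B -> u != v -> F u v = - F v u) ->
  \sum_(u in B) \sum_(v in B :\ u) F u v = 0.
Proof.
move=> Fas.
have splitE u : u \in B -> \sum_(v in B :\ u) F u v =
  \sum_(v in B | (v < u)%N) F u v + \sum_(v in B | (u < v)%N) F u v.
  move=> uB; rewrite (bigID (fun v => (v < u)%N)) /=; congr (_ + _).
    apply: eq_bigl => v; rewrite !inE -val_eqE /=.
    by case: ltngtP; rewrite ?andbT ?andbF.
  apply: eq_bigl => v; rewrite !inE -val_eqE /=.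
  by case: ltngtP; rewrite ?andbT ?andbF.
rewrite (eq_bigr _ splitE) big_split /= addrC.
rewrite (exchange_big_dep (mem B)) /=; last by move=> u v _ /andP[].
rewrite -big_split big1 //= => v vB.
rewrite vB /= -big_split big1 //= => u /andP[uB uv].
by rewrite Fas ?addNr // -val_eqE neq_ltn uv.
Qed.

Lemma kos_kos x f B : kos x (kos x f) B = 0.
Proof.
rewrite /kos; under eq_bigr do rewrite scaler_sumr.
under eq_bigr do under eq_bigr do rewrite scalerA.
apply: antisym_sum => u v uB vB uv.
rewrite !setDDl [[set v] :|: _]setUC -scaleNr; congr (_ *: _).
set C := B :\: ([set u] :|: [set v]).
have vE : B :\ v = u |: C.
  by apply/setP=> w; rewrite /C !inE; case: (eqVneq w u) => [->|] /=; rewrite ?uB ?uv.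
have uE : B :\ u = v |: C.
  apply/setP=> w; rewrite /C !inE; case: (eqVneq w v) => [->|] /=; last by rewrite orbF.
  by rewrite vB eq_sym uv.
have uC : u \notin C by rewrite /C !inE eqxx.
have vC : v \notin C by rewrite /C !inE eqxx orbT.
rewrite vE uE mulrACA eps_swap // mulNr; congr (- _).
by rewrite [RHS]mulrACA [x u * _]mulrC.
Qed.

Lemma kosD x f g B : kos x (fun A => f A + g A) B = kos x f B + kos x g B.
Proof. by rewrite -big_split; apply: eq_bigr => v _; rewrite scalerDr. Qed.

Lemma kosN x f B : kos x (fun A => - f A) B = - kos x f B.
Proof. by rewrite -sumrN; apply: eq_bigr => v _; rewrite scalerN. Qed.

Lemma kosB x f g B : kos x (fun A => f A - g A) B = kos x f B - kos x g B.
Proof. by rewrite kosD kosN. Qed.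

Lemma eq_kos x f g B : (forall v, v \in B -> f (B :\ v) = g (B :\ v)) ->
  kos x f B = kos x g B.
Proof. by move=> fg; apply: eq_bigr => v vB; rewrite fg. Qed.

Lemma kos0 x f B : (forall v, v \in B -> f (B :\ v) = 0) -> kos x f B = 0.
Proof. by move=> f0; apply: big1 => v vB; rewrite f0 // scaler0. Qed.

End Kos.

(** * Acyclic families of sets: exact sequences, cones, links and unions *)

Section Acyclic.
Variables (n : nat) (K : fieldType).
Implicit Types (u v : 'I_n) (A B C T : {set 'I_n}) (k : nat).
Implicit Types (P Q : pred {set 'I_n}) (f g : {set 'I_n} -> K^o).

Notation d := (kos (fun=> 1 : K)).

Definition supported P k f := forall A, f A != 0 -> P A /\ #|A| = k.

(* The cochains of degree [k] on [P] live on the members of cardinality [k],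
   so [k] is one more than the dimension of the corresponding simplices. *)
Definition acyc P k := forall f, supported P k f ->
  (forall B, P B -> d f B = 0) ->
  exists2 g, (forall A, g A != 0 -> P A /\ #|A|.+1 = k)
           & forall B, P B -> d g B = f B.

(** The condition that makes the coboundary truncated to [P] square to zero. *)
Definition convex P := forall A B C, A \subset B -> B \subset C -> P A -> P C -> P B.

Lemma eq_acyc P Q k : P =1 Q -> acyc P k -> acyc Q k.
Proof.
move=> PQ aP f fs fc; case: (aP f) => [A /fs|B|g gs gf]; rewrite ?PQ //.
  by move/fc.
by exists g => [A /gs|B QB]; rewrite -?PQ // gf // PQ.
Qed.

Lemma acyc_nocard P k : (forall A, P A -> #|A| != k) -> acyc P k.
Proof.
move=> Pk f fs fc; exists (fun=> 0) => [A|B PB]; first by rewrite eqxx.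
rewrite kos0 //; apply/esym/eqP; apply: contraT => /fs[_ /eqP].
by rewrite (negPf (Pk _ PB)).
Qed.

Definition restr Q f A := if Q A then f A else 0.

Lemma d_supp P k f B : (forall A, f A != 0 -> P A /\ #|A|.+1 = k) ->
  d f B != 0 -> (exists A, [/\ A \subset B & P A]) /\ #|B| = k.
Proof.
move=> fs dB.
have [v /andP[vB fv]] : exists v, (v \in B) && (f (B :\ v) != 0).
  apply/existsP; apply: contraNT dB; rewrite negb_exists => /forallP nf.
  by apply/eqP/kos0 => v vB; have := nf v; rewrite vB /= negbK => /eqP.
have [PBv kE] := fs _ fv; split; first by exists (B :\ v); rewrite subsetDl.
by rewrite -kE [in LHS](cardsD1 v) vB.
Qed.

Lemma d_restr_d P k f B : convex P -> (forall A, f A != 0 -> P A /\ #|A|.+1 = k) ->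
  P B -> d (restr P (d f)) B = 0.
Proof.
move=> cP fs PB; rewrite -[RHS](kos_kos (fun=> 1) f B); apply: eq_kos => v vB.
rewrite /restr; case: ifPn => // nP; apply/esym/eqP; apply: contraNT nP.
case/(d_supp fs)=> -[A [AB PA]] _.
by apply: cP PA PB; rewrite ?subsetDl.
Qed.

Section Pair.
Variables (P Q : pred {set 'I_n}).
Hypotheses (cP : convex P).
Hypothesis upQ : forall A B, A \subset B -> P A -> P B -> Q A -> Q B.

Let PQ := [pred A | P A && Q A].
Let PnQ := [pred A | P A && ~~ Q A].

Let d_PQ k g B : supported PQ k g -> PnQ B -> d g B = 0.
Proof.
move=> gs /andP[PB nQB]; apply: kos0 => v vB; apply/eqP; apply: contraNT nQB.
by case/gs=> /andP[PA QA] _; apply: upQ PA PB QA; rewrite subsetDl.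
Qed.

Let d_restr k g B : supported P k g -> PnQ B -> d (restr (predC Q) g) B = d g B.
Proof.
move=> gs /andP[PB nQB]; apply: eq_kos => v vB; rewrite /restr /=.
case: ifPn => //; rewrite negbK => QA; apply/esym/eqP; apply: contraNT nQB => gn.
by case: (gs _ gn) => PA _; apply: upQ PA PB QA; rewrite subsetDl.
Qed.

Lemma restr_supp k g : supported P k g -> supported PnQ k (restr (predC Q) g).
Proof.
move=> gs A; rewrite /restr /=; case: ifP => [nQA /gs[PA ->]|_]; last by rewrite eqxx.
by split=> //; rewrite /PnQ /= PA.
Qed.

(** As [Q] is inherited upwards, the cochains on [PQ] form a subcomplex of those on [P], with
    quotient the cochains on [PnQ]. This is exactness at the middle term of the long exact
    sequence. *)
Lemma acyc_glue k : acyc PQ k -> acyc PnQ k -> acyc P k.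
Proof.
move=> aQ anQ f fs fc.
case: (anQ (restr (predC Q) f)) => [|B PB|g1 g1s g1f].
- exact: restr_supp.
- by rewrite (d_restr fs PB) fc //; case/andP: PB.
have g1sP A : g1 A != 0 -> P A /\ #|A|.+1 = k by case/g1s=> /andP[].
(* Subtracting a coboundary kills [f] on [PnQ]; what remains is a cocycle on [PQ]. *)
pose f2 A := f A - restr P (d g1) A.
case: (aQ f2) => [A|B|g2 g2s g2f].
- rewrite /f2 /restr; case: ifP => PA f2n.
    split; last first.
      case: (eqVneq (f A) 0) f2n => [->|/fs[_ //]]; rewrite sub0r oppr_eq0.
      by case/(d_supp g1sP).
    rewrite /PQ /= PA /=; apply: contraNT f2n => nQA; rewrite g1f /= ?PA //.
    by rewrite /restr /= nQA subrr.
  by move: f2n; rewrite subr0 => /fs[]; rewrite PA.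
- by case/andP=> PB _; rewrite kosB (d_restr_d cP g1sP) // subr0 fc.
exists (fun A => g1 A + g2 A) => [A|B PB].
  case: (eqVneq (g1 A) 0) => [->|/g1sP//]; rewrite add0r.
  by case/g2s=> /andP[].
rewrite kosD; case QB: (Q B).
  by rewrite g2f /= ?PB ?QB // /f2 /restr PB addrC subrK.
have nB : PnQ B by rewrite /= PB QB.
rewrite g1f // (@d_PQ k.-1 g2) ?addr0 // /restr /= ?QB // => A /g2s[-> <-] //.
Qed.

(** Exactness of the same sequence at [H^(k+1)(PQ)], between [H^k(PnQ)] and [H^(k+1)(P)]. *)
Lemma acyc_sub k : acyc P k.+1 -> acyc PnQ k -> acyc PQ k.+1.
Proof.
move=> aP anQ f fs fc; case: (aP f) => [A /fs[/andP[]]//|B PB|g gs gf].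
  case QB: (Q B); first by rewrite fc //= PB QB.
  by rewrite (d_PQ fs) //= PB QB.
have gsk : supported P k g by move=> A /gs[? []].
case: (anQ (restr (predC Q) g)) => [|B nB|h hs hg].
- exact: restr_supp.
- rewrite (d_restr gsk nB); case/andP: nB => PB nQB; rewrite gf //.
  apply/eqP; apply: contraNT nQB => /fs[/andP[]] //.
have hsP A : h A != 0 -> P A /\ #|A|.+1 = k by case/hs=> /andP[].
exists (fun A => g A - restr P (d h) A) => [A gn|B /andP[PB QB]]; last first.
  by rewrite kosB gf // (d_restr_d cP hsP) // subr0.
have [PA kA] : P A /\ #|A| = k.
  case: (eqVneq (g A) 0) gn => [->|/gs[? []]//].
  rewrite sub0r oppr_eq0 /restr; case: ifP; rewrite ?eqxx // => PA.
  by case/(d_supp hsP).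
rewrite kA /PQ /= PA; split=> //=; apply: contraNT gn => nQA.
by rewrite /restr PA hg /= ?PA // /restr /= nQA subrr.
Qed.

(** Exactness at [H^k(PnQ)], between [H^k(P)] and [H^(k+1)(PQ)]. *)
Lemma acyc_quot k : acyc P k -> acyc PQ k.+1 -> acyc PnQ k.
Proof.
move=> aP aQ f fs fc.
have fsP A : f A != 0 -> P A /\ #|A|.+1 = k.+1 by case/fs=> /andP[PA _] ->.
case: (aQ (restr P (d f))) => [A|B /andP[PB _]|h hs hf].
- rewrite /restr; case: ifP; rewrite ?eqxx // => PA dn.
  case: (d_supp fsP dn) => _ ->; split=> //=; rewrite PA.
  by apply: contraNT dn => nQA; rewrite fc //= PA.
- exact: (d_restr_d cP fsP).
have hsk : supported PQ k h by move=> A /hs[? []].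
case: (aP (fun A => f A - h A)) => [A|B PB|g gs gf].
- case: (eqVneq (f A) 0) => [->|/fsP[? []]//]; rewrite sub0r oppr_eq0.
  by case/hsk=> /andP[].
- rewrite kosB; case QB: (Q B); first by rewrite hf /= ?PB // /restr PB subrr.
  by rewrite fc ?(d_PQ hsk) ?subr0 //= PB QB.
exists (restr (predC Q) g) => [A|B nB].
  rewrite /restr /=; case: ifP => [nQA /gs[PA ->]|_]; last by rewrite eqxx.
  by rewrite PA.
rewrite (@d_restr k.-1) => [|A /gs[? <-]|] //; case/andP: nB => PB nQB.
rewrite gf //; case: (eqVneq (h B) 0) => [->|/hs[/andP[_]]]; first by rewrite subr0.
by rewrite (negPf nQB).
Qed.

End Pair.

(** Membership does not depend on [v], so evaluating [f] at [v |: A], with its sign, is a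
    contracting homotopy. *)
Lemma acyc_cone v P k : (forall A, P (v |: A) = P (A :\ v)) -> acyc P k.
Proof.
move=> Pv f fs fc.
exists (fun A => if v \in A then 0 else eps K v A * f (v |: A)) => [A|B PB].
  case: ifPn => vA; rewrite ?eqxx // mulf_eq0 negb_or => /andP[_ /fs].
  by rewrite Pv cardsU1 vA add1n; have /setDidPl -> : [disjoint A & [set v]];
    rewrite 1?disjoint_sym ?disjoints1.
case vB: (v \in B).
  rewrite /kos (bigD1 v) //= big1 ?addr0 => [|w /andP[wB wv]]; last first.
    by rewrite !inE vB eq_sym wv scaler0.
  by rewrite !inE eqxx /= setD1K // mulr1 /GRing.scale /= mulrA epsM mul1r.
have vNB := negbT vB.
(* The cocycle condition at [v |: B] expresses [f B] through the values of [f] at sets containing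
   [v]. *)
have := fc (v |: B); rewrite Pv; have -> : B :\ v = B.
  by apply/setDidPl; rewrite disjoint_sym disjoints1.
move=> /(_ PB); rewrite /kos big_setU1 //= setU1K // mulr1.
move/eqP; rewrite addr_eq0 => /eqP/(congr1 (fun y => eps K v B * y)).
rewrite {1}/GRing.scale /= mulrA epsM mul1r => ->.
rewrite mulrN mulr_sumr -sumrN; apply: eq_bigr => w wB.
have wv : w != v by apply: contraTneq wB => ->.
have vBw : v \notin B :\ w by rewrite !inE vB andbF.
rewrite !inE vB andbF mulr1 /GRing.scale /=.
have -> : (v |: B) :\ w = v |: (B :\ w).
  by apply/setP=> y; rewrite !inE; case: (eqVneq y v) => [->|//]; rewrite eq_sym wv.
have wBw : w \notin B :\ w by rewrite !inE eqxx.
have sw := eps_swap K wv wBw vBw; rewrite (setD1K wB) in sw.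
have -> : eps K w (v |: B :\ w) = - (eps K v B * eps K w (B :\ w)) * eps K v (B :\ w).
  by rewrite -sw -mulrA epsM mulr1.
by rewrite mulr1 !mulNr mulrN opprK !mulrA epsM mul1r.
Qed.

Definition downclosed P := forall A B, A \subset B -> P B -> P A.

Lemma downclosed_convex P : downclosed P -> convex P.
Proof. by move=> dP A B C _ BC _; apply: dP. Qed.

Lemma convexD P Q : convex P -> (forall A B, A \subset B -> P A -> P B -> Q A -> Q B) ->
  convex [pred A | P A && ~~ Q A].
Proof.
move=> cP upQ A B C AB BC /andP[PA nQA] /andP[PC nQC].
have PB := cP _ _ _ AB BC PA PC.
by rewrite /= PB; apply: contra nQC; apply: upQ.
Qed.

Lemma convex_shift1 v P : convex P -> convex [pred A : {set 'I_n} | P (A :\ v)].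
Proof. by move=> cP A B C AB BC /=; apply: cP; rewrite setSD. Qed.

(* The family of all [A] with [A :\ v] in [P] is a cone over [v]. *)
Lemma acyc_shift1 v P k : convex P -> (forall A, P A -> v \notin A) ->
  acyc [pred A : {set 'I_n} | (v \in A) && P (A :\ v)] k.+1 <-> acyc P k.
Proof.
move=> cP vP; pose P' := [pred A : {set 'I_n} | P (A :\ v)].
have cP' : convex P' by apply: convex_shift1.
have aP' j : acyc P' j.
  apply: (@acyc_cone v) => A /=; congr (P _).
  by apply/setP=> w; rewrite !inE; case: eqP.
have upv A B : A \subset B -> P' A -> P' B -> v \in A -> v \in B.
  by move=> /subsetP AB _ _; apply: AB.
have E1 : [pred A : {set 'I_n} | P' A && (v \in A)]
    =1 [pred A : {set 'I_n} | (v \in A) && P (A :\ v)] by move=> A; rewrite /= andbC.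
have E2 : [pred A : {set 'I_n} | P' A && (v \notin A)] =1 P.
  move=> A /=; case: (boolP (v \in A)) => vA; rewrite (andbT, andbF).
    by apply/esym/negP=> /vP; rewrite vA.
  by congr (P _); apply/setDidPl; rewrite disjoint_sym disjoints1.
split=> a.
  apply: eq_acyc E2 _; apply: (acyc_quot cP' upv) => //.
  by apply: eq_acyc a => A; rewrite E1.
apply: eq_acyc E1 _; apply: (acyc_sub cP' upv) => //.
by apply: eq_acyc a => A; rewrite E2.
Qed.

Lemma acyc_shift T P k : convex P -> (forall A, P A -> [disjoint A & T]) ->
  acyc [pred A : {set 'I_n} | (T \subset A) && P (A :\: T)] (#|T| + k) <-> acyc P k.
Proof.
move: {2}#|T| (erefl #|T|) => t; elim: t T P k => [|t IH] T P k cT cP PT.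
  have -> : T = set0 by apply/eqP; rewrite -cards_eq0 cT.
  have E : P =1 [pred A : {set 'I_n} | (set0 \subset A) && P (A :\: set0)].
    by move=> A; rewrite /= sub0set setD0.
  by rewrite cards0; split; apply: eq_acyc.
have /card_gt0P[v vT] : (0 < #|T|)%N by rewrite cT.
have vP A : P A -> v \notin A.
  by move/PT; rewrite disjoint_sym => /disjointFr/(_ vT) ->.
pose P1 := [pred A : {set 'I_n} | (v \in A) && P (A :\ v)].
have cT' : #|T :\ v| = t by apply: succn_inj; rewrite -cT [in RHS](cardsD1 v) vT.
have cP1 : convex P1.
  move=> A B C AB BC /andP[vA PA] /andP[vC PC] /=; rewrite (subsetP AB) //=.
  exact: convex_shift1 cP _ _ _ AB BC PA PC.
have P1T A : P1 A -> [disjoint A & T :\ v].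
  move=> /andP[vA /PT]; rewrite disjoint_sym => dA; rewrite disjoint_sym.
  rewrite disjoint_subset; apply/subsetP=> w; rewrite !inE => /andP[wv wT].
  by have := disjointFr dA wT; rewrite !inE wv => /= ->.
apply: iff_trans (acyc_shift1 k cP vP); apply: iff_trans (IH _ _ k.+1 cT' cP1 P1T).
rewrite cT' cT addSnnS.
have E : [pred A : {set 'I_n} | (T \subset A) && P (A :\: T)]
    =1 [pred A : {set 'I_n} | (T :\ v \subset A) && P1 (A :\: (T :\ v))].
  move=> A; rewrite /= -{1}(setD1K vT) subUset sub1set !inE eqxx /= andbA.
  congr (_ && P _); first by rewrite andbC.
  by apply/setP=> w; rewrite !inE; case: (eqVneq w v) => [->|]; rewrite ?vT.
by split; apply: eq_acyc => A; rewrite E.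
Qed.

Definition link T P : pred {set 'I_n} :=
  [pred B : {set 'I_n} | [disjoint B & T] && P (B :|: T)].

Lemma link_down T P : downclosed P -> downclosed (link T P).
Proof.
move=> dP A B AB /andP[BT PB]; rewrite /link /= (disjointWl AB BT).
by apply: dP PB; rewrite setSU.
Qed.

Lemma acyc_link T P k : downclosed P -> acyc (link T P) k ->
  acyc [pred A : {set 'I_n} | (T \subset A) && P A] (#|T| + k).
Proof.
move=> dP al; have lT A : link T P A -> [disjoint A & T] by case/andP.
have cl := downclosed_convex (@link_down T P dP).
apply: eq_acyc (proj2 (acyc_shift k cl lT) al) => A /=.
case: (boolP (T \subset A)) => //= TA; rewrite /link /= disjoints_subset.
rewrite setDE subsetIr; congr (P _); rewrite -setDE.
by rewrite setUC -{1}(setIidPr TA) setID.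
Qed.

(** Mayer-Vietoris: the sets of [P2] outside [P1] are the upper part both of the union over [P1] and
    of [P2] over the intersection, so two pair sequences combine. *)
Lemma acyc_union P1 P2 k : downclosed P1 -> downclosed P2 ->
  acyc P1 k.+1 -> acyc P2 k.+1 -> acyc [pred A | P1 A && P2 A] k ->
  acyc [pred A | P1 A || P2 A] k.+1.
Proof.
move=> d1 d2 a1 a2 a12.
have upQ P A B : A \subset B -> P A -> P B -> predC P1 A -> predC P1 B.
  by move=> AB _ _ /=; apply: contra; apply: d1.
have dP : downclosed [pred A | P1 A || P2 A].
  by move=> A B AB /orP[/(d1 _ _ AB)|/(d2 _ _ AB)] /= ->; rewrite ?orbT.
apply: (acyc_glue (downclosed_convex dP) (@upQ _)).
  have E : [pred A | P2 A && predC P1 A] =1 [pred A | (P1 A || P2 A) && predC P1 A].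
    by move=> A /=; case: (P1 A); rewrite ?andbF.
  apply: eq_acyc E _; apply: (acyc_sub (downclosed_convex d2) (@upQ _) a2).
  by apply: eq_acyc a12 => A /=; rewrite negbK andbC.
by apply: eq_acyc a1 => A /=; rewrite negbK; case: (P1 A); rewrite ?andbF.
Qed.

(* The larger family is the suspension of [P] with apexes [u] and [v]. *)
Lemma acyc_desuspend u v P k : convex P ->
  (forall A, P A -> (u \notin A) && (v \notin A)) -> u != v ->
  acyc [pred A : {set 'I_n} | P (A :\ u :\ v) && ~~ ((u \in A) && (v \in A))] k.+1 ->
  acyc P k.
Proof.
move=> cP PN uv; set S := (X in acyc X _) => aS.
have cS : convex S.
  move=> A B C AB BC /andP[PA _] /andP[PC nC].
  apply/andP; split; first exact: (@convex_shift1 u _ (@convex_shift1 v _ cP) A B C).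
  by apply: contra nC => /andP[uB vB]; rewrite !(subsetP BC).
have upQ A B : A \subset B -> S A -> S B -> v \in A -> v \in B.
  by move=> /subsetP AB _ _; apply: AB.
apply/(@acyc_shift1 v) => //; first by move=> A /PN/andP[].
have E : [pred A : {set 'I_n} | S A && (v \in A)]
    =1 [pred A : {set 'I_n} | (v \in A) && P (A :\ v)].
  move=> A; rewrite /S /= andbC; case vA: (v \in A) => //=; rewrite andbT.
  case: (boolP (u \in A)) => uA /=; rewrite ?andbT ?andbF.
    by apply/esym/negP=> /PN; rewrite !inE uA uv.
  by congr (P (_ :\ _)); apply/setDidPl; rewrite disjoint_sym disjoints1.
apply: eq_acyc E _; apply: (acyc_sub cS upQ aS).
apply: (@acyc_cone u) => A; rewrite /S /= !inE eqxx [v == u]eq_sym (negPf uv) /=.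
case: (v \in A); rewrite ?andbF //= !andbT; congr (P _).
by apply/setP=> w; rewrite !inE; case: (w == u).
Qed.

Definition avoids (L : seq {set 'I_n}) A := all (fun l : {set 'I_n} => ~~ (l \subset A)) L.

(** Filtration by the first member of [L] contained in a set: the sets containing the head of [L]
    are split off, and the convex rest is treated by induction. *)
Lemma acyc_first (L : seq {set 'I_n}) P k : convex P ->
  acyc [pred A | P A && avoids L A] k ->
  (forall L1 l L2, L = L1 ++ l :: L2 ->
     acyc [pred A : {set 'I_n} | P A && (l \subset A) && avoids L1 A] k) ->
  acyc P k.
Proof.
elim: L P => [|l L IH] P cP a0 aL.
  by apply: eq_acyc a0 => A /=; rewrite andbT.
have upQ A B : A \subset B -> P A -> P B -> l \subset A -> l \subset B.
  by move=> AB _ _ lA; apply: subset_trans AB.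
apply: (acyc_glue cP upQ).
  by apply: eq_acyc (aL [::] l L erefl) => A /=; rewrite andbT.
apply: IH; first exact: convexD.
  by apply: eq_acyc a0 => A /=; rewrite andbA.
move=> L1 l1 L2 LE; apply: eq_acyc (aL (l :: L1) l1 L2 _) => [A|]; last by rewrite LE.
by rewrite /= -!andbA; congr (_ && _); rewrite andbCA.
Qed.

End Acyclic.


(** * Independence complexes *)

Section Independence.
Variables (n : nat) (K : fieldType).
Implicit Types (A B C Z W : {set 'I_n}) (k : nat) (s u v x y : 'I_n).
Local Notation acyc := (@acyc n K).

Definition indep (e : rel 'I_n) A := [forall x in A, forall y in A, ~~ e x y].

Definition Ind e Z : pred {set 'I_n} :=
  [pred A : {set 'I_n} | (A \subset Z) && indep e A].

Definition av (e : rel 'I_n) s B := [forall x in B, ~~ e s x].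

Lemma indepP e A : reflect {in A &, forall x y, ~~ e x y} (indep e A).
Proof.
apply: (iffP forall_inP) => [iA x y xA|iA x xA]; first exact: (forall_inP (iA x xA) y).
by apply/forall_inP=> y; apply: iA.
Qed.

Lemma avP e s B : reflect {in B, forall x, ~~ e s x} (av e s B).
Proof. exact: forall_inP. Qed.

Lemma indepS e A B : A \subset B -> indep e B -> indep e A.
Proof. by move=> /subsetP AB /indepP iB; apply/indepP=> x y /AB xB /AB; apply: iB. Qed.

Lemma avS e s A B : A \subset B -> av e s B -> av e s A.
Proof. by move=> /subsetP AB /avP aB; apply/avP=> x /AB; apply: aB. Qed.

Lemma indepU1 e s A : ssrbool.symmetric e -> irreflexive e ->
  indep e (s |: A) = indep e A && av e s A.
Proof.
move=> e_sym e_irr; apply/indepP/andP=> [iA|[/indepP iA /avP aA] x y].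
  split; first by apply/indepP=> x y xA yA; apply: iA; rewrite !inE ?xA ?yA orbT.
  by apply/avP=> x xA; apply: iA; rewrite !inE ?xA ?eqxx ?orbT.
rewrite !inE => /orP[/eqP->|xA] /orP[/eqP->|yA]; rewrite ?e_irr //.
- exact: aA.
- by rewrite e_sym aA.
- exact: iA.
Qed.

Lemma Ind_down e Z : downclosed (Ind e Z).
Proof.
move=> A B AB /andP[BZ iB]; rewrite /Ind /= (subset_trans AB BZ).
exact: indepS iB.
Qed.

Lemma Ind_convex e Z : convex (Ind e Z).
Proof. exact/downclosed_convex/Ind_down. Qed.

Lemma Ind_del e Z v A : Ind e (Z :\ v) A = Ind e Z A && (v \notin A).
Proof. by rewrite /Ind /= subsetD1 andbAC. Qed.

Lemma Ind_link e Z v A : ssrbool.symmetric e -> ~~ e v v -> v \in Z ->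
  Ind e Z A && (v \in A) =
  (v \in A) && Ind e [set x in Z :\ v | ~~ e v x] (A :\ v).
Proof.
move=> e_sym evv vZ; rewrite andbC; case: (boolP (v \in A)) => //= vA.
apply/andP/andP=> [[/subsetP AZ /indepP iA]|[/subsetP AZ /indepP iA]]; split.
- by apply/subsetP=> x; rewrite !inE => /andP[-> xA]; rewrite AZ //= iA.
- by apply: indepS (subsetDl _ _) _; apply/indepP.
- apply/subsetP=> x xA; case: (eqVneq x v) => [-> //|xv].
  by have := AZ x; rewrite !inE xv xA => /(_ isT)/andP[].
have adj x : x \in A -> ~~ e v x.
  case: (eqVneq x v) => [->|xv xA] //.
  by have := AZ x; rewrite !inE xv xA => /(_ isT)/andP[].
apply/indepP=> x y xA yA.
case: (eqVneq x v) => [->|xv]; first exact: adj.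
case: (eqVneq y v) => [->|yv]; first by rewrite e_sym adj.
by apply: iA; rewrite !inE ?xv ?yv.
Qed.

Lemma Ind_half e Z k : ssrbool.symmetric e -> (#|Z| < k.*2)%N -> acyc (Ind e Z) k.
Proof.
move=> e_sym; have [N] := ubnP #|Z|; elim: N Z k => // N IH Z k.
rewrite ltnS => ZN Zk; case: (set_0Vmem Z) => [Z0|[v vZ]].
  apply: acyc_nocard => A /andP[]; rewrite Z0 subset0 => /eqP-> _.
  by rewrite cards0; case: k Zk => //; rewrite ltn0.
have cZ := cardsD1 v Z; rewrite vZ in cZ.
have aD : acyc (Ind e (Z :\ v)) k by apply: IH; lia.
have [evv|evv] := boolP (e v v).
  apply: eq_acyc aD => A; rewrite Ind_del; case: (boolP (Ind e Z A)) => //= /andP[_].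
  by move/indepP=> iA; apply/negP=> vA; have := iA v v vA vA; rewrite evv.
have [iso|] := boolP (av e v Z).
  apply: (@acyc_cone _ _ v) => A; apply/andP/andP=> [] [/subsetP AZ /indepP iA]; split.
  - by apply/subsetP=> x; rewrite !inE => /andP[_ xA]; rewrite AZ // !inE xA orbT.
  - apply/indepP=> x y; rewrite !inE => /andP[_ xA] /andP[_ yA].
    by apply: iA; rewrite !inE ?xA ?yA orbT.
  - apply/subsetP=> x; rewrite !inE; case: eqP => [->|/eqP xv] //= xA.
    by apply: AZ; rewrite !inE xv.
  have AZ' x : x \in A -> x \in Z.
    by case: (eqVneq x v) => [->|xv xA] //; apply: AZ; rewrite !inE xv.
  apply/indepP=> x y; rewrite !inE; move/avP: iso => iso.
  case: (eqVneq x v) => [->|xv] /=; case: (eqVneq y v) => [->|yv] //=.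
  - by move=> _ /AZ'/iso.
  - by move=> /AZ'/iso; rewrite e_sym.
  - by move=> xA yA; apply: iA; rewrite !inE ?xv ?yv.
rewrite negb_forall_in => /existsP[u /andP[uZ]]; rewrite negbK => evu.
have uv : u != v by apply: contraTneq evu => ->.
apply: (@acyc_glue _ _ _ [pred A : {set 'I_n} | v \in A] (@Ind_convex e Z)).
- by move=> A B /subsetP AB _ _; apply: AB.
- case: k Zk aD => [|k] Zk aD; first by lia.
  (* [Z'] misses both [v] and its neighbour [u], which pays for the degree lost in passing to the
     link. *)
  set Z' := [set x in Z :\ v | ~~ e v x].
  have aL : acyc (Ind e Z') k.
    have Z'Z : Z' \subset Z :\ v :\ u.
      apply/subsetP=> x; rewrite !inE => /andP[/andP[-> ->] evx]; rewrite !andbT.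
      by apply: contraNneq evx => ->.
    have := subset_leq_card Z'Z; have := cardsD1 u (Z :\ v); rewrite !inE uv uZ.
    by move=> *; apply: IH; lia.
  have vZ' A : Ind e Z' A -> v \notin A.
    by case/andP=> /subsetP AZ _; apply/negP=> /AZ; rewrite !inE eqxx.
  have /(acyc_shift1 K k (@Ind_convex e Z') vZ') := aL.
  by apply: eq_acyc => A; rewrite /= -[RHS]/(Ind e Z A && (v \in A)) Ind_link.
- by apply: eq_acyc aD => A; rewrite Ind_del.
Qed.

Lemma desuspend_edge e u v Z k : ssrbool.symmetric e -> irreflexive e ->
  e u v -> u \notin Z -> v \notin Z -> av e u Z -> av e v Z ->
  acyc (Ind e (u |: (v |: Z))) k.+1 -> acyc (Ind e Z) k.
Proof.
move=> e_sym e_irr euv uZ vZ auZ avZ aS.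
have uv : u != v by apply: contraTneq euv => ->; rewrite e_irr.
apply: (@acyc_desuspend _ _ u v) => //; first exact: Ind_convex.
  move=> A /andP[/subsetP AZ _].
  by rewrite (contra (AZ u)) // (contra (AZ v)).
apply: eq_acyc aS => A; rewrite /Ind /=.
have -> : (A \subset u |: (v |: Z)) = (A :\ u :\ v \subset Z).
  apply/subsetP/subsetP=> AZ x.
    by rewrite !inE => /and3P[xv xu /AZ]; rewrite !inE (negPf xv) (negPf xu).
  by have := AZ x; rewrite !inE; case: eqP => //=; case: eqP.
case: (boolP (_ \subset Z)) => //= /subsetP AZ.
apply/indepP/andP=> [iA|[/indepP iA nuv] x y xA yA].
  split; last by apply/negP=> /andP[uA vA]; have := iA u v uA vA; rewrite euv.
  by apply: indepS (subset_trans (subsetDl _ _) (subsetDl _ _)) _; apply/indepP.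
have inZ w : w \in A -> w != u -> w != v -> w \in A :\ u :\ v.
  by move=> wA wu wv; rewrite !inE wA wu wv.
move/avP: auZ => auZ; move/avP: avZ => avZ.
case: (eqVneq x u) xA => [->|xu] xA.
  case: (eqVneq y u) => [->|yu]; first by rewrite e_irr.
  case: (eqVneq y v) yA => [->|yv] yA; first by rewrite xA yA in nuv.
  by apply/auZ/AZ/inZ.
case: (eqVneq x v) xA => [->|xv] xA.
  case: (eqVneq y v) => [->|yv]; first by rewrite e_irr.
  case: (eqVneq y u) yA => [->|yu] yA; first by rewrite xA yA in nuv.
  by apply/avZ/AZ/inZ.
case: (eqVneq y u) yA => [->|yu] yA; first by rewrite e_sym; apply/auZ/AZ/inZ.
case: (eqVneq y v) yA => [->|yv] yA; first by rewrite e_sym; apply/avZ/AZ/inZ.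
by apply: iA; apply: inZ.
Qed.

(** * Third-level complexes attached to two disjoint edges *)

Section ThirdLevel.
Variables (e : rel 'I_n).
Hypotheses (e_sym : ssrbool.symmetric e) (e_irr : irreflexive e).
Variables (a b c d : 'I_n) (V : {set 'I_n}).
Hypotheses (eab : e a b) (ecd : e c d).
Hypothesis abcd : uniq [:: a; b; c; d].
Hypothesis VN : all (fun s => s \notin V) [:: a; b; c; d].

(** The four cases run over the ends of [ab] and [cd] that survive when one vertex of each edge is
    removed. *)
Definition extends B :=
  [|| [&& ~~ e a c, av e a B & av e c B], [&& ~~ e a d, av e a B & av e d B],
      [&& ~~ e b c, av e b B & av e c B] | [&& ~~ e b d, av e b B & av e d B]].

Definition third := [pred B | Ind e V B && extends B].

Lemma extendsS A B : A \subset B -> extends B -> extends A.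
Proof.
move=> AB /or4P[] /and3P[n1 /(avS AB) n2 /(avS AB) n3];
  by rewrite /extends n1 n2 n3 ?orbT.
Qed.

(* Helly property: a vertex set extends as soon as each of its pairs does,
   so [third] is the independence complex of an auxiliary relation. *)
Lemma extends_helly B : extends set0 ->
  {in B &, forall x y, extends [set x; y]} -> extends B.
Proof.
case: (set_0Vmem B) => [-> //|[x0 x0B] _ HB].
(* For each of the four ends, one vertex of [B] decides whether it has a neighbour in [B]. The claim
   becomes a finite Boolean check on pairs of these witnesses. *)
have wit s : exists2 w, w \in B & av e s B = ~~ e s w.
  case: (boolP (av e s B)) => [/avP aB|]; first by exists x0; rewrite ?aB.
  rewrite negb_forall_in => /existsP[w /andP[wB]]; rewrite negbK => ew.
  by exists w; rewrite ?ew.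
have av2 s x y : av e s [set x; y] = ~~ e s x && ~~ e s y.
  apply/avP/andP=> [as2|[sx sy] z]; first by rewrite !as2 ?inE ?eqxx ?orbT.
  by rewrite !inE => /orP[] /eqP->.
have avw s w ws : w \in B -> av e s B = ~~ e s ws -> e s w ==> e s ws.
  by move=> wB; case: (e s ws); rewrite ?implybT // => /avP/(_ w wB)/negPf->.
have [wa waB Ea] := wit a; have [wb wbB Eb] := wit b.
have [wc wcB Ec] := wit c; have [wd wdB Ed] := wit d.
have G x y (xB : x \in B) (yB : y \in B) := HB x y xB yB.
move: (avw a wb wa wbB Ea) (avw a wc wa wcB Ea) (avw a wd wa wdB Ea)
  (avw b wa wb waB Eb) (avw b wc wb wcB Eb) (avw b wd wb wdB Eb)
  (avw c wa wc waB Ec) (avw c wb wc wbB Ec) (avw c wd wc wdB Ec)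
  (avw d wa wd waB Ed) (avw d wb wd wbB Ed) (avw d wc wd wcB Ed).
move: (G wa wb waB wbB) (G wc wd wcB wdB) (G wa wc waB wcB)  (G wa wd waB wdB)
  (G wb wc wbB wcB) (G wb wd wbB wdB).
rewrite /extends !av2 Ea Eb Ec Ed.
case: (e a wa) => /=; case: (e b wb) => /=; case: (e c wc) => /=; case: (e d wd) => //=;
  do ?[case: (e _ _) => //=].
Qed.

Lemma third_half k : (#|V| < k.*2)%N -> acyc third k.
Proof.
move=> Vk; have [X0|X0] := boolP (extends set0); last first.
  apply: acyc_nocard => A /andP[_ /(extendsS (sub0set A))].
  by rewrite (negPf X0).
(* This relation has a loop at [x] when [[set x]] does not extend. *)
pose e2 := [rel x y | ~~ (indep e [set x; y] && extends [set x; y])].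
have e2_sym : ssrbool.symmetric e2 by move=> x y; rewrite /e2 /= setUC.
apply: eq_acyc (Ind_half e2_sym Vk) => A; rewrite /third /Ind /= -andbA.
congr (_ && _); apply/indepP/andP=> [iA|[/indepP iA XA] x y xA yA].
  have iA' x y xA yA := iA x y xA yA : ~~ ~~ (_ && _).
  split; last first.
    by apply: extends_helly => // x y xA yA; have := iA' x y xA yA; rewrite negbK => /andP[].
  apply/indepP=> x y xA yA; have := iA' x y xA yA; rewrite negbK => /andP[/indepP i2 _].
  by apply: i2; rewrite !inE eqxx ?orbT.
have sA : [set x; y] \subset A by rewrite subUset !sub1set xA.
by rewrite /e2 /= negbK (extendsS sA) ?andbT //; apply: indepS sA _; apply/indepP.
Qed.

(** * Vanishing for third-level complexes from vanishing for independence complexes *)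

Section Regularity.
Variable m : nat.
Hypothesis regm : forall Z k, (m <= k)%N -> acyc (Ind e Z) k.

Implicit Types ss : seq 'I_n.

Definition free ss : pred {set 'I_n} := [pred B | Ind e V B && all (fun t => av e t B) ss].

Lemma freeE ss : free ss =1 Ind e [set x in V | all (fun t => ~~ e t x) ss].
Proof.
move=> A; rewrite /free /Ind /= andbAC; congr (_ && _).
apply/andP/subsetP=> [[/subsetP AV /allP sA] x xA|AV].
  by rewrite inE AV //=; apply/allP=> t /sA/avP; apply.
split; first by apply/subsetP=> x /AV; rewrite inE => /andP[].
apply/allP=> t ts; apply/avP=> x /AV; rewrite inE => /andP[_ /allP]; exact.
Qed.

Lemma free_down ss : downclosed (free ss).
Proof.
by move=> A B AB; rewrite !freeE; apply: Ind_down.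
Qed.

Lemma free_acyc ss k : (m <= k)%N -> acyc (free ss) k.
Proof. by move=> mk; have := eq_acyc (fsym (freeE ss)); apply; exact: regm.  Qed.

Let aV : a \notin V. Proof. by case/and5P: VN. Qed.
Let bV : b \notin V. Proof. by case/and5P: VN. Qed.
Let cV : c \notin V. Proof. by case/and5P: VN. Qed.
Let dV : d \notin V. Proof. by case/and5P: VN. Qed.

(** No vertex kept by [free ss] is adjacent to [u] or [v]; adding both back is a suspension, so
    vanishing starts one degree lower than for general [ss]. *)
Lemma free_acyc_edge ss u v k : e u v -> u \in ss -> v \in ss ->
  u \notin V -> v \notin V -> (m <= k.+1)%N -> acyc (free ss) k.
Proof.
move=> euv us vs uV vV mk.
set Z := [set x in V | all (fun t => ~~ e t x) ss].
have avZ t : t \in ss -> av e t Z.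
  by move=> ts; apply/avP=> x; rewrite inE => /andP[_ /allP]; exact.
apply: eq_acyc (fsym (freeE _)) _; rewrite -/Z.
apply: (desuspend_edge e_sym e_irr euv); rewrite ?avZ //.
- by rewrite inE negb_and uV.
- by rewrite inE negb_and vV.
- exact: regm.
Qed.

(** With no edge between [ab] and [cd], two successive suspensions are possible, and the gain is two
    degrees. *)
Lemma free_acyc_2edges k : ~~ e a c -> ~~ e a d -> ~~ e b c -> ~~ e b d ->
  (m <= k.+2)%N -> acyc (free [:: c; d; a; b]) k.
Proof.
move=> nac nad nbc nbd mk.
set Z := [set x in V | all (fun t => ~~ e t x) [:: c; d; a; b]].
have avZ t : t \in [:: c; d; a; b] -> av e t Z.
  by move=> ts; apply/avP=> x; rewrite inE => /andP[_ /allP]; exact.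
have NZ t : t \notin V -> t \notin Z by move=> tV; rewrite inE negb_and tV.
have [/= ] := andP abcd.
rewrite !inE !negb_or => /and3P[ab ac ad] /and3P[/andP[bc bd] cd _].
apply: eq_acyc (fsym (freeE _)) _; rewrite -/Z.
apply: (desuspend_edge e_sym e_irr ecd); rewrite ?avZ ?NZ ?inE ?eqxx ?orbT //.
have avU t : ~~ e t c -> ~~ e t d -> av e t Z -> av e t (c |: (d |: Z)).
  move=> tc td /avP tZ; apply/avP=> x; rewrite !in_setU1.
  by case/or3P=> [/eqP->|/eqP->|] //; apply: tZ.
apply: (desuspend_edge e_sym e_irr eab).
- by rewrite !inE (negPf ac) (negPf ad) /= negb_and aV.
- by rewrite !inE (negPf bc) (negPf bd) /= negb_and bV.
- by rewrite avU // avZ // !inE eqxx ?orbT.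
- by rewrite avU // avZ // !inE eqxx ?orbT.
- exact: regm.
Qed.

(** The only face of [Ind e set0] is empty, which gives cohomology in degree zero; its suspension by
    the edge [ab] then has cohomology in degree one. *)
Lemma reg_ge2 : (2 <= m)%N.
Proof.
rewrite leqNgt; apply/negP=> m1.
have : acyc (Ind e set0) 0.
  apply: (desuspend_edge e_sym e_irr eab); rewrite ?inE //; last by apply: regm; lia.
    by apply/avP=> x; rewrite inE.
  by apply/avP=> x; rewrite inE.
have I0 : Ind e set0 set0.
  by rewrite /Ind /= sub0set; apply/indepP=> x y; rewrite inE.
have k0 (f : {set 'I_n} -> K^o) : kos (fun=> 1) f set0 = 0.
  by rewrite kos0 // => v; rewrite inE.
case/(_ (fun A => (A == set0)%:R)) => [A|B|g _ /(_ _ I0)].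
- by case: (eqVneq A set0) => [->|]; rewrite ?eqxx ?cards0.
- by rewrite /Ind /= subset0 => /andP[/eqP-> _].
by rewrite k0 eqxx => /eqP; rewrite eq_sym oner_eq0.
Qed.

Definition row ss (f1 f2 : bool) : pred {set 'I_n} :=
  [pred B | (f1 && free (c :: ss) B) || (f2 && free (d :: ss) B)].

Lemma row_down ss f1 f2 : downclosed (row ss f1 f2).
Proof.
move=> A B AB /orP[] /andP[f /(free_down AB) FA]; rewrite /row /=.
  by rewrite -/(free (c :: ss) A) f FA.
by rewrite -/(free (d :: ss) A) f FA orbT.
Qed.

Lemma row_acyc ss (f1 f2 : bool) k : acyc (free (c :: ss)) k.+1 -> acyc (free (d :: ss)) k.+1 ->
  (f1 -> f2 -> acyc (free [:: c, d & ss]) k) -> acyc (row ss f1 f2) k.+1.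
Proof.
move=> a1 a2 a12; case: f1 f2 a12 => [] [] a12.
- apply: (acyc_union (@free_down _) (@free_down _) a1 a2).
  apply: eq_acyc (a12 isT isT) => A; rewrite /free /=.
  by case: (Ind e V A); case: (av e c A); case: (av e d A); case: (all _ _).
- by apply: eq_acyc a1 => A; rewrite /row /= orbF.
- by apply: eq_acyc a2 => A.
- by apply: acyc_nocard => A.
Qed.

(** Mayer-Vietoris over the rows of [a] and [b], each being itself a union over [c] and [d]. Every
    intersection involves an edge with both ends in the list given to [free], and the degree gained
    there makes up for the one that Mayer-Vietoris loses. *)
Lemma third_reg k : (m <= k)%N -> acyc third k.
Proof.
have := reg_ge2; case: k => [|[|k]] m2 mk; try by lia.
pose R p := row [:: p] (~~ e p c) (~~ e p d).
have aR p : acyc (R p) k.+2.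
  apply: row_acyc; try exact: free_acyc.
  move=> _ _; apply: (free_acyc_edge ecd); rewrite ?inE ?eqxx ?orbT //.
have E : [pred A | R a A || R b A] =1 third.
  move=> A; rewrite /R /row /third /free /extends /=.
  case: (Ind e V A) => //=; rewrite ?andbF // !andbT.
  by case: (av e a A); case: (av e b A); case: (av e c A); case: (av e d A);
    rewrite ?andbT ?andbF ?orbF //= ?orbA.
apply: eq_acyc E _; apply: acyc_union (aR a) (aR b) _; try exact: row_down.
have eabk ss : a \in ss -> b \in ss -> acyc (free ss) k.+1.
  by move=> *; apply: (free_acyc_edge eab).
pose g1 := ~~ e a c && ~~ e b c; pose g2 := ~~ e a d && ~~ e b d.
(* If [c] or [d] is adjacent to neither [a] nor [b], the mixed intersections, which are free of all
   four ends, lie inside the row of [[:: a; b]]. *)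
have [g|] := boolP (g1 || g2).
  apply: (@eq_acyc _ _ (row [:: a; b] g1 g2)) => [A|]; last first.
    apply: row_acyc; try by apply: eabk; rewrite !inE eqxx ?orbT.
    by move=> /andP[? ?] /andP[? ?]; apply: free_acyc_2edges.
  move: g; rewrite /R /row /free /g1 /g2 /=.
  case: (Ind e V A) => /=; rewrite ?andbF //.
  by case: (av e a A); case: (av e b A); case: (av e c A); case: (av e d A);
    case: (e a c); case: (e a d); case: (e b c); case: (e b d).
rewrite negb_or => ng.
(* Otherwise only mixed intersections survive, and each of them is [free [:: c; d; a; b]]. Below,
   [pred1 h \o fun=> true] is the constant [h]. *)
pose h := (~~ e a c && ~~ e b d) || (~~ e a d && ~~ e b c).
apply: (@eq_acyc _ _ (predI (pred1 h \o fun=> true) (free [:: c; d; a; b]))) => [A|].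
  move: ng; rewrite /R /row /free /g1 /g2 /h /=.
  case: (Ind e V A) => /=; rewrite ?andbF //.
  by case: (av e a A); case: (av e b A); case: (av e c A); case: (av e d A);
    case: (e a c); case: (e a d); case: (e b c); case: (e b d).
case: h; last by apply: acyc_nocard => A.
by apply: eabk; rewrite !inE eqxx ?orbT.
Qed.

End Regularity.

End ThirdLevel.

End Independence.


(** * Sets that are independent up to two vertices *)

Section NearFaces.
Variables (n : nat) (K : fieldType) (e : rel 'I_n).
Hypotheses (e_sym : ssrbool.symmetric e) (e_irr : irreflexive e).
Implicit Types (A B C R X Z W V : {set 'I_n}) (k : nat) (a b c d x y : 'I_n).
Local Notation acyc := (@acyc n K).

(* The faces of the Stanley-Reisner complex of the squarefree part of the third
   symbolic power: a vertex cover may meet a face in at most two points. *)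
Definition near_indep A :=
  [exists C : {set 'I_n}, [&& C \subset A, (#|C| <= 2)%N & indep e (A :\: C)]].

Definition near_faces W : pred {set 'I_n} :=
  [pred A : {set 'I_n} | (A \subset W) && near_indep A].

Lemma near_indepS A B : A \subset B -> near_indep B -> near_indep A.
Proof.
move=> AB /existsP[C /and3P[CB C2 iC]]; apply/existsP; exists (C :&: A).
rewrite subsetIr (leq_trans (subset_leq_card (subsetIl _ _)) C2) /=.
apply: indepS iC; apply/subsetP=> x; rewrite !inE => /andP[nC xA].
by rewrite (subsetP AB) // andbT; apply: contra nC => ->.
Qed.

Lemma near_faces_down W : downclosed (near_faces W).
Proof.
move=> A B AB /andP[BW iB]; rewrite /near_faces /= (subset_trans AB BW).
exact: near_indepS iB.
Qed.

Definition edges : {set {set 'I_n}} :=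
  [set l : {set 'I_n} | [exists a, exists b, e a b && (l == [set a; b])]].

Lemma edgesP l : reflect (exists a b, e a b /\ l = [set a; b]) (l \in edges).
Proof.
rewrite inE; apply: (iffP existsP) => [[a /existsP[b /andP[ab /eqP->]]]|].
  by exists a, b.
by case=> a [b [ab ->]]; exists a; apply/existsP; exists b; rewrite ab /=.
Qed.

Lemma avoids_edges A : avoids (enum edges) A = indep e A.
Proof.
apply/allP/indepP=> [aA x y xA yA|iA l].
  apply/negP=> xy; have := aA [set x; y]; rewrite mem_enum subUset !sub1set xA yA.
  by move=> /(_ _)/negP[] //; apply/edgesP; exists x, y.
rewrite mem_enum => /edgesP[a [b [ab ->]]]; rewrite subUset !sub1set.
by apply/negP=> /andP[aA bA]; have := iA a b aA bA; rewrite ab.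
Qed.

Lemma avoidsS L A B : A \subset B -> avoids L B -> avoids L A.
Proof.
by move=> AB /allP LB; apply/allP=> l /LB; apply: contra => /subset_trans; apply.
Qed.

(* An edge inside the union of an independent [R] and [X] has at most one end
   outside [X]. *)
Lemma avoidsU L R X : {subset L <= edges} -> indep e R ->
  avoids L (R :|: X) = avoids L X && [forall v in R, avoids L (v |: X)].
Proof.
move=> Le /indepP iR; apply/idP/andP=> [aU|[aX /forall_inP aR]].
  split; first exact: avoidsS (subsetUr _ _) aU.
  by apply/forall_inP=> v vR; apply: avoidsS aU; rewrite setSU ?sub1set.
apply/allP=> l lL; have /edgesP[a [b [ab lE]]] := Le l lL.
rewrite lE subUset !sub1set; apply/negP=> /andP[]; rewrite !inE.
have NX Y : avoids L Y -> a \in Y -> b \in Y -> False.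
  by move=> /allP/(_ l lL); rewrite lE subUset !sub1set => nY aY bY; rewrite aY bY in nY.
case: (boolP (a \in X)) => aX'; case: (boolP (b \in X)) => bX'; rewrite ?orbF ?orbT.
- by move=> _ _; apply: (NX X).
- by move=> _ bR; apply: (NX (b |: X)); rewrite ?aR // !inE ?eqxx ?aX' ?orbT.
- by move=> aR' _; apply: (NX (a |: X)); rewrite ?aR // !inE ?eqxx ?bX' ?orbT.
- by move=> aR' bR; have := iR a b aR' bR; rewrite ab.
Qed.

(** The removed vertices must meet two disjoint edges, so one is taken from each, and the surviving
    ends together with [R] must be independent. *)
Lemma near_indepU2 a b c d R : e a b -> e c d -> uniq [:: a; b; c; d] ->
  [disjoint R & [set a; b]] -> [disjoint R & [set c; d]] ->
  near_indep (R :|: [set c; d] :|: [set a; b]) = indep e R && extends e a b c d R.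
Proof.
move=> eab ecd abcd Rab Rcd; set A := R :|: _ :|: _.
move: (abcd); rewrite /= !inE !negb_or => /and4P[/and3P[ab ac ad] /andP[bc bd] cd _].
have RN s : s \in [:: a; b; c; d] -> s \notin R.
  have NR t : t \in R -> [/\ t != a, t != b, t != c & t != d].
    move=> tR; have := disjointFr Rab tR; have := disjointFr Rcd tR.
    by rewrite !inE; do 4!case: eqP.
  by move=> sL; apply/negP=> /NR []; move: sL; rewrite !inE => /or4P[] ->.
have RA : R \subset A by rewrite /A -setUA subsetUl.
have inA s : (s \in A) = (s \in R) || (s \in [:: a; b; c; d]).
  by rewrite /A !inE -orbA; congr (_ || _); do 4!case: (_ == _).
apply/existsP/andP=> [[C /and3P[CA C2 /indepP iC]]|[iR]].
  have pick x y : e x y -> x \in A -> y \in A -> (x \in C) || (y \in C).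
    move=> exy xA yA; rewrite -[_ || _]negbK negb_or; apply/negP=> /andP[xC yC].
    by have := iC x y; rewrite !in_setD xC yC xA yA exy => /(_ isT isT).
  (* [C] contains one end of each edge and has at most two elements, so it is [[set p; q]], and the
     rest of [A] is independent. *)
  have done p q p' q' : p != q -> p \in C -> q \in C ->
      p' \in A -> q' \in A -> p' \notin [:: p; q] -> q' \notin [:: p; q] ->
      p \notin R -> q \notin R ->
      [/\ indep e R, ~~ e p' q', av e p' R & av e q' R].
    move=> pq pC qC p'A q'A; rewrite !inE => p'N q'N pR qR.
    have CE : C = [set p; q].
      by apply/esym/eqP; rewrite eqEcard subUset !sub1set pC qC cards2 pq.
    have inD x : x \in A -> x != p -> x != q -> x \in A :\: C.
      by move=> xA xp xq; rewrite CE in_setD in_set2 negb_or xp xq.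
    have RD x : x \in R -> x \in A :\: C.
      move=> xR; apply: inD; first exact: (subsetP RA).
        by apply: contraTneq xR => ->.
      by apply: contraTneq xR => ->.
    have [p'p p'q] := norP p'N; have [q'p q'q] := norP q'N.
    split.
    - by apply/indepP=> x y /RD xD /RD; apply: iC.
    - by apply: iC; apply: inD.
    - by apply/avP=> x /RD; apply: iC; apply: inD.
    - by apply/avP=> x /RD; apply: iC; apply: inD.
  have aA : a \in A by rewrite inA !inE eqxx ?orbT.
  have bA : b \in A by rewrite inA !inE eqxx ?orbT.
  have cA : c \in A by rewrite inA !inE eqxx ?orbT.
  have dA : d \in A by rewrite inA !inE eqxx ?orbT.
  have aR : a \notin R by apply: RN; rewrite !inE eqxx ?orbT.
  have bR : b \notin R by apply: RN; rewrite !inE eqxx ?orbT.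
  have cR : c \notin R by apply: RN; rewrite !inE eqxx ?orbT.
  have dR : d \notin R by apply: RN; rewrite !inE eqxx ?orbT.
  have [ba ca da] : [/\ b != a, c != a & d != a] by split; rewrite eq_sym.
  have [cb db dc] : [/\ c != b, d != b & d != c] by split; rewrite eq_sym.
  have D := (ab, ac, ad, bc, bd, cd, (ba, ca, da, cb, db, dc)).
  case/orP: (pick a b eab aA bA) => pC; case/orP: (pick c d ecd cA dA) => qC.
  - have [||-> H1 H2 H3] := done a c b d ac pC qC bA dA _ _ aR cR;
      by rewrite ?inE ?negb_or ?D // /extends H1 H2 H3 ?orbT.
  - have [||-> H1 H2 H3] := done a d b c ad pC qC bA cA _ _ aR dR;
      by rewrite ?inE ?negb_or ?D // /extends H1 H2 H3 ?orbT.
  - have [||-> H1 H2 H3] := done b c a d bc pC qC aA dA _ _ bR cR;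
      by rewrite ?inE ?negb_or ?D // /extends H1 H2 H3 ?orbT.
  - have [||-> H1 H2 H3] := done b d a c bd pC qC aA cA _ _ bR dR;
      by rewrite ?inE ?negb_or ?D // /extends H1 H2 H3 ?orbT.
have done p q p' q' : [:: p'; q'; p; q] =i [:: a; b; c; d] ->
    [&& ~~ e p q, av e p R & av e q R] ->
    exists C : {set 'I_n}, [&& C \subset A, (#|C| <= 2)%N & indep e (A :\: C)].
  move=> pE /and3P[npq pR qR]; exists [set p'; q'].
  rewrite subUset !sub1set !inA -!pE !inE !eqxx !orbT /= cards2 ltnS leq_b1 /=.
  apply: (@indepS _ _ _ (p |: (q |: R))).
    apply/subsetP=> x; rewrite in_setD in_set2 inA -pE !inE.
    by case: (x \in R); do 4!case: (_ == _).
  rewrite !indepU1 // iR qR /=; apply/avP=> x; rewrite in_setU1.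
  by case/orP=> [/eqP-> //|]; apply: (avP _ _ _ pR).
case/or4P=> H.
- by apply: (done _ _ b d _ H) => x; rewrite !inE; do 4!case: (_ == _).
- by apply: (done _ _ b c _ H) => x; rewrite !inE; do 4!case: (_ == _).
- by apply: (done _ _ a d _ H) => x; rewrite !inE; do 4!case: (_ == _).
- by apply: (done _ _ a c _ H) => x; rewrite !inE; do 4!case: (_ == _).
Qed.

(** Each edge split off lowers both the degree and the number of available vertices by two, whence
    the degrees [k.+4], [k.+2], [k] and the bounds on [#|Z|] and [#|V|]. *)
Lemma near_faces_acyc W k :
  acyc (Ind e W) k.+4 ->
  (forall Z a b, (#|Z|.+2 <= #|W|)%N -> e a b -> acyc (Ind e Z) k.+2) ->
  (forall V a b c d, (#|V| + 4 <= #|W|)%N -> e a b -> e c d ->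
     uniq [:: a; b; c; d] -> all (fun s => s \notin V) [:: a; b; c; d] ->
     acyc (third e a b c d V) k) ->
  acyc (near_faces W) k.+4.
Proof.
move=> aI aZ aV; set L := enum edges.
have convF : convex (near_faces W) by apply/downclosed_convex/near_faces_down.
apply: (acyc_first (L := L)) => // [|L1 l L2 LE].
  apply: eq_acyc aI => A; rewrite /near_faces /= avoids_edges -andbA.
  congr (_ && _); case: (boolP (indep e A)) => iA; rewrite (andbF, andbT) //.
  by apply/esym/existsP; exists set0; rewrite sub0set cards0 setD0 iA.
have Ledge l0 : l0 \in L -> l0 \in edges by rewrite mem_enum.
have L1e : {subset L1 <= edges}.
  by move=> l0 l0L; apply: Ledge; rewrite LE mem_cat l0L.
have /edgesP[a [b [eab lE]]] : l \in edges.
  by apply: Ledge; rewrite LE mem_cat inE eqxx orbT.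
have ab : a != b by apply: contraTneq eab => ->; rewrite e_irr.
set F1 := [pred A | near_faces W A && avoids L1 A].
have dF1 : downclosed F1.
  by move=> A B AB /andP[/(near_faces_down AB) fB /(avoidsS AB) aB]; apply/andP.
suff aF1 : acyc (link l F1) k.+2.
  have : acyc [pred A : {set 'I_n} | (l \subset A) && F1 A] (#|l| + k.+2).
    exact: acyc_link.
  by rewrite lE cards2 ab -lE; apply: eq_acyc => A; rewrite /= -andbA andbCA.
(* If this test fails, the link of [l] has no members at all. *)
have [lW|lW] := boolP ((l \subset W) && avoids L1 l); last first.
  apply: acyc_nocard => B /andP[_ /andP[/andP[sW _] sL]]; case/negP: lW.
  by rewrite (subset_trans _ sW) ?subsetUr // (avoidsS _ sL) ?subsetUr.
case/andP: lW => lW aL1; have dl := link_down (T := l) dF1.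
apply: (acyc_first (L := L) (downclosed_convex dl)) => [|L3 l' L4 LE'].
  (* By [avoidsU], avoiding the earlier edges is a condition on single vertices, so it is absorbed
     into the vertex set. *)
  set Z := [set v in W :\: l | avoids L1 (v |: l)].
  have : acyc (Ind e Z) k.+2.
    apply: aZ eab; rewrite -addn2 -(cardsID l W) addnC leq_add //.
      by rewrite (setIidPr lW) lE cards2 ab.
    by apply: subset_leq_card; apply/subsetP=> v; rewrite inE => /andP[].
  apply: eq_acyc => A; rewrite /= avoids_edges /Ind /= andbC [RHS]andbC.
  case: (boolP (indep e A)) => //= iA; rewrite /link /F1 /near_faces /= avoidsU // aL1 /=.
  have -> : near_indep (A :|: l).
    apply/existsP; exists l; rewrite subsetUr lE cards2 ltnS leq_b1 /= -lE.
    by apply: indepS iA; rewrite setDUl setDv setU0 subsetDl.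
  rewrite subUset lW !andbT; apply/subsetP/and3P=> [AZ|[Al AW /forall_inP aA] v vA].
    split; first 2 last.
    - by apply/forall_inP=> v /AZ; rewrite inE => /andP[].
    - by rewrite disjoints_subset; apply/subsetP=> v /AZ; rewrite !inE => /andP[/andP[]].
    - by apply/subsetP=> v /AZ; rewrite !inE => /andP[/andP[]].
  by rewrite inE aA // !inE (subsetP AW) // (disjointFr Al vA).
have L3e : {subset L3 <= edges}.
  by move=> l0 l0L; apply: Ledge; rewrite LE' mem_cat l0L.
have /edgesP[c [d [ecd lE']]] : l' \in edges.
  by apply: Ledge; rewrite LE' mem_cat inE eqxx orbT.
have cd : c != d by apply: contraTneq ecd => ->; rewrite e_irr.
set F2 := [pred A | link l F1 A && avoids L3 A].
have dF2 : downclosed F2.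
  by move=> A B AB /andP[/(dl _ _ AB) fB /(avoidsS AB) aB]; apply/andP.
suff aF2 : acyc (link l' F2) k.
  have : acyc [pred A : {set 'I_n} | (l' \subset A) && F2 A] (#|l'| + k).
    exact: acyc_link.
  by rewrite lE' cards2 cd -lE'; apply: eq_acyc => A; rewrite /= -andbA andbCA.
have [good|bad] := boolP [&& [disjoint l' & l], l' \subset W,
    avoids L1 (l' :|: l) & avoids L3 l']; last first.
  apply: acyc_nocard => B /andP[_ /andP[/andP[sl /andP[/andP[sW _] sL]] sL3]].
  have sU : l' \subset B :|: l' by rewrite subsetUr.
  case/negP: bad; rewrite (disjointWl sU sl) (avoidsS sU sL3) andbT /=.
  rewrite (avoidsS (setSU _ sU) sL) andbT.
  by apply: subset_trans sW; rewrite -setUA subsetU // subsetUl orbT.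
case/and4P: good => ll lW' aL1' aL3'.
(* [L1] is tested together with both edges, but [L3] only with [l'], because it filters sets from
   which [l] has already been removed. *)
set V := [set v in W :\: (l' :|: l) | avoids L1 (v |: (l' :|: l)) && avoids L3 (v |: l')].
have abcd : uniq [:: a; b; c; d].
  move: ll; rewrite lE lE' disjoints_subset subUset !sub1set !inE !negb_or.
  rewrite /= !inE !negb_or ab cd ![c == _]eq_sym ![d == _]eq_sym.
  by case/andP=> [/andP[-> ->] /andP[-> ->]].
have : acyc (third e a b c d V) k.
  apply: aV => //.
    have -> : 4%N = #|l' :|: l|.
      by rewrite cardsU (disjoint_setI0 ll) cards0 subn0 lE lE' !cards2 ab cd.
    rewrite -(cardsID (l' :|: l) W) addnC leq_add //.
      have /setIidPr-> // : l' :|: l \subset W by rewrite subUset lW'.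
    by apply: subset_leq_card; apply/subsetP=> v; rewrite inE => /andP[].
  by apply/allP=> s sl; rewrite inE negb_and lE lE' !inE; move: sl; rewrite !inE;
    case/or4P=> ->; rewrite ?orbT.
apply: eq_acyc => A; rewrite /third /Ind /link /F2 /= /link /F1 /near_faces /=.
have [Al'|Al'] := boolP [disjoint A & l']; last first.
  rewrite /=; apply/negP=> /andP[/andP[/subsetP AV _] _].
  case/negP: Al'; rewrite disjoints_subset; apply/subsetP=> v /AV.
  by rewrite !inE => /andP[/andP[/norP[]]].
have [Al|Al] := boolP [disjoint A & l]; last first.
  have -> : [disjoint A :|: l' & l] = false.
    by apply: contraNF Al; apply: disjointWl; rewrite subsetUl.
  rewrite andbF; apply/negP=> /andP[/andP[/subsetP AV _] _].
  case/negP: Al; rewrite disjoints_subset; apply/subsetP=> v /AV.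
  by rewrite !inE => /andP[/andP[/norP[]]].
have -> : [disjoint A :|: l' & l] by rewrite disjoints_subset subUset -!disjoints_subset Al.
have -> : near_indep (A :|: l' :|: l) = indep e A && extends e a b c d A.
  by rewrite lE lE' near_indepU2 -?lE -?lE'.
rewrite -setUA.
case: (boolP (indep e A)) => iA /=; rewrite ?andbF //=.
rewrite (avoidsU (l' :|: l) L1e iA) (avoidsU _ L3e iA) aL1' aL3' /=.
case: (extends _ _ _ _ _ _); rewrite ?andbF //= !andbT.
rewrite !subUset lW lW' !andbT.
apply/subsetP/andP=> [AV|[/andP[AW /forall_inP a1] /forall_inP a2] v vA].
  split; [apply/andP; split|].
  - by apply/subsetP=> v /AV; rewrite !inE => /andP[/andP[]].
  - by apply/forall_inP=> v /AV; rewrite !inE => /and3P[].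
  - by apply/forall_inP=> v /AV; rewrite !inE => /and3P[].
by rewrite inE a1 // a2 // !inE (subsetP AW) // (disjointFr Al vA) (disjointFr Al' vA).
Qed.

Lemma near_faces_reg m W k : (forall Z i, (m <= i)%N -> acyc (Ind e Z) i) ->
  (m + 4 <= k)%N -> acyc (near_faces W) k.
Proof.
move=> regm mk; rewrite -(subnK (leq_trans (leq_addl _ _) mk)) addn4.
apply: near_faces_acyc => [|Z a b _ _|V a b c d _ eab ecd abcd VN].
- by apply: regm; lia.
- by apply: regm; lia.
- by apply: (third_reg e_sym e_irr eab ecd abcd VN regm); lia.
Qed.

(** The constant comes from the third level: for [k = k' + 4] one has [#|V| <= n - 4], and
    [n - 4 < 2 k'] holds as soon as [k' >= n %/ 2 - 1]. *)
Lemma near_faces_half W k : (n %/ 2 + 3 <= k)%N -> acyc (near_faces W) k.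
Proof.
move=> nk; have Wn : (#|W| <= n)%N by rewrite -[X in (_ <= X)%N](card_ord n) max_card.
(* In this case [k = 3] and [n <= 1], so [W] is too small. *)
have [k4|k4] := ltnP k 4.
  apply: acyc_nocard => A /andP[/subset_leq_card AW _]; apply/eqP.
  by move: AW; lia.
rewrite -(subnK k4) addn4.
apply: near_faces_acyc => [|Z a b ZW _|V a b c d VW eab ecd abcd VN].
- by apply: Ind_half => //; lia.
- by apply: Ind_half => //; lia.
- apply: third_half => //; lia.
Qed.

End NearFaces.


(** * Koszul cohomology and minimal free resolutions *)

Lemma sum_neq0 (V : nmodType) (I : finType) (P : pred I) (F : I -> V) :
  \sum_(i | P i) F i != 0 -> exists2 i, P i & F i != 0.
Proof.
move=> nz; have /existsP[i /andP[]] : [exists i, P i && (F i != 0)]; last by exists i.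
apply: contraNT nz; rewrite negb_exists => /forallP nk.
by apply/eqP/big1 => i Pi; apply/eqP; have := nk i; rewrite Pi negbK.
Qed.

Section Coefficients.
Variables (n : nat) (K : fieldType).
Local Notation S := {mpoly K[n]}.
Implicit Types (p q : S) (m : 'X_{1..n}) (v : 'I_n).

Lemma mcoeff_mulX v p m :
  ('X_v * p)@_m = if m v == 0%N then 0 else p@_(m - U_(v)).
Proof.
rewrite mulrC; case: eqP => [m0|/eqP mv].
  apply/eqP; rewrite -[_ == 0]negbK -mcoeff_msupp; apply/negP.
  rewrite (perm_mem (msuppMX p U_(v))) => /mapP[m' _ mE].
  by move: m0; rewrite mE mnmDE mnm1E eqxx.
rewrite -[m in LHS](@submK _ U_(v)) 1?addmC ?mcoeffMX //.
apply/mnm_lepP=> w; rewrite mnm1E; case: eqP => // <-.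
by rewrite lt0n.
Qed.

Lemma mcoeff_mul_neq0 p q m : (p * q)@_m != 0 ->
  exists m1 m2, [/\ m = (m1 + m2)%MM, p@_m1 != 0 & q@_m2 != 0].
Proof.
rewrite mcoeffM => /sum_neq0[k /eqP mE].
by rewrite mulf_eq0 negb_or => /andP[k1 k2]; exists k.1, k.2.
Qed.

Lemma mcoeff0M p q : (p * q)@_0 = p@_0 * q@_0.
Proof. exact: rmorphM. Qed.

Definition mpart (P : pred 'X_{1..n}) p : S :=
  \sum_(m <- msupp p | P m) p@_m *: 'X_[m].

Lemma mcoeff_mpart P p m : (mpart P p)@_m = if P m then p@_m else 0.
Proof.
rewrite /mpart raddf_sum /= (eq_bigr (fun k => (k == m)%:R * p@_k)) => [|k _]; last first.
  by rewrite mcoeffZ mcoeffX mulrC.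
have [mp|mp] := boolP (m \in msupp p); last first.
  rewrite big1_seq => [|k /andP[_ kp]]; last first.
    by case: eqP kp mp => [-> ->|]; rewrite ?mul0r.
  by rewrite mcoeff_msupp negbK in mp; rewrite (eqP mp); case: ifP.
rewrite big_mkcond (bigD1_seq m) //= ?msupp_uniq // eqxx mul1r big1 ?addr0 // => k km.
by case: ifP; rewrite // (negPf km) mul0r.
Qed.

End Coefficients.

(** * The Koszul complex and its multigraded strands *)

Section Koszul.
Variables (n : nat) (K : fieldType).
Local Notation S := {mpoly K[n]}.
Implicit Types (A B : {set 'I_n}) (m alpha : 'X_{1..n}) (i j k : nat).

Notation kosX := (kos (fun v => 'X_v : S)).
Notation d1 := (kos (fun=> 1 : K)).

(** Exponent of the exterior monomial placed at [A]. It lives on the complement, so the differential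
    enlarges sets while the homological degree [n - #|A|] drops. *)
Definition coind A : 'X_{1..n} := [multinom (v \notin A : nat) | v < n].
Definition supp m : {set 'I_n} := [set v | m v != 0%N].

Lemma mdeg_coind A : (mdeg (coind A) + #|A| = n)%N.
Proof.
rewrite mdegE; under eq_bigr do rewrite mnmE.
rewrite -big_mkcond /= sum1_card.
rewrite addnC -[RHS]card_ord -(cardsC A); congr (_ + _)%N.
by apply: eq_card => v; rewrite !inE.
Qed.

Lemma coindD1 v A : v \in A -> coind (A :\ v) = (coind A + U_(v))%MM.
Proof.
move=> vA; apply/mnmP=> w; rewrite mnmDE !mnmE !inE eq_sym.
by case: (eqVneq v w) => [<-|]; rewrite ?vA ?addn0.
Qed.

Lemma coindD1_le v A alpha : v \in A -> (coind A <= alpha)%MM ->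
  (coind (A :\ v) <= alpha)%MM = ((alpha - coind A)%MM v != 0%N).
Proof.
move=> vA /mnm_lepP cA; rewrite coindD1 //.
have cv : coind A v = 0%N by rewrite mnmE vA.
apply/mnm_lepP/idP => [/(_ v)|].
  by rewrite mnmDE mnmBE mnm1E eqxx cv subn0 lt0n.
rewrite mnmBE cv subn0 => av w; rewrite mnmDE mnm1E.
by case: eqP => [<-|_]; rewrite ?addn0 // cv add0n lt0n.
Qed.

Lemma eps_mpoly v A : eps S v A = (eps K v A)%:MP.
Proof. by rewrite /eps rmorphXn /= rmorphN1. Qed.

Section Comp.
Variable (q : nat).
Implicit Types (z y : {set 'I_n} -> 'rV[S]_q) (c : 'I_q).

(* The multidegree [alpha] of [X^m] in the summand [A] is [m + coind A]: it is
   preserved by the Koszul differential. *)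
Definition kcomp z c alpha A : K^o :=
  if (coind A <= alpha)%MM then (z A 0 c)@_(alpha - coind A) else 0.

Lemma comp_addE z c m A : kcomp z c (m + coind A) A = (z A 0 c)@_m.
Proof. by rewrite /kcomp lem_addl addmK. Qed.

Lemma comp_kos z c alpha B : (coind B <= alpha)%MM ->
  kcomp (kosX z) c alpha B = d1 (kcomp z c alpha) B.
Proof.
move=> Ba; rewrite /kcomp Ba /kos summxE raddf_sum /=; apply: eq_bigr => v vB.
rewrite mxE -mulrA eps_mpoly mcoeffCM mcoeff_mulX mulr1 coindD1_le //.
case: eqP => _ //=; rewrite /GRing.scale /=; congr (_ * (_ @_ _)).
by rewrite coindD1 // submDA.
Qed.

Definition kdeg (dg : 'I_q -> nat) i j z := forall A c m,
  (z A 0 c)@_m != 0 -> (#|A| + i = n /\ mdeg m + dg c + i = j)%N.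

Lemma kdeg_comp dg i j z c alpha A : kdeg dg i j z -> kcomp z c alpha A != 0 ->
  [/\ (coind A <= alpha)%MM, (#|A| + i = n)%N & (mdeg alpha + dg c = j)%N].
Proof.
rewrite /kcomp => hz; case: ifP => [Aa|]; last by rewrite eqxx.
case/hz=> Ai <-; split=> //.
rewrite -{1}(submK Aa) mdegD; have := mdeg_coind A; lia.
Qed.

Lemma comp_eq z y : (forall c alpha A, (coind A <= alpha)%MM ->
  kcomp z c alpha A = kcomp y c alpha A) -> z =1 y.
Proof.
move=> zy A; apply/rowP=> c; apply/mpolyP=> m.
by rewrite -!comp_addE zy ?lem_addl.
Qed.

Definition supports_in (U : pred {set 'I_n}) (v : 'rV[S]_q) :=
  forall c m, (v 0 c)@_m != 0 -> U (supp m).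

(** The positions [A] at which the module has a monomial of multidegree [alpha], namely
    ['X_[alpha - coind A]]. *)
Definition strand (U : pred {set 'I_n}) alpha : pred {set 'I_n} :=
  [pred A : {set 'I_n} | (coind A <= alpha)%MM && U (supp (alpha - coind A))].

End Comp.

Section Lift.
Variables (q : nat) (dg : 'I_q -> nat) (U : pred {set 'I_n}).
Hypothesis upU : forall A B, A \subset B -> U A -> U B.

Lemma strand_up alpha v B : v \in B -> (coind B <= alpha)%MM ->
  strand U alpha (B :\ v) -> strand U alpha B.
Proof.
move=> vB Ba /andP[_ Uv]; rewrite /strand /= Ba; apply: upU Uv.
apply/subsetP=> w; rewrite !inE !mnmE !inE.
by case: (eqVneq w v) => [->|_] /=; rewrite ?vB /=; lia.
Qed.

Lemma d1_strand alpha (f : {set 'I_n} -> K^o) B : (forall A, f A != 0 -> strand U alpha A) ->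
  (coind B <= alpha)%MM -> ~~ strand U alpha B -> d1 f B = 0.
Proof.
move=> fs Ba nB; apply: kos0 => v vB; apply/eqP; apply: contraNT nB => /fs.
exact: strand_up.
Qed.

(** The differential preserves multidegrees: a cycle is lifted separately for each pair
    [(c, alpha)], and the lifts are reassembled into polynomials. *)
Lemma kos_lift i j (z : {set 'I_n} -> 'rV[S]_q) :
  kdeg dg i j z -> (forall A, supports_in U (z A)) -> (forall B, kosX z B = 0) ->
  (forall c alpha A, kcomp z c alpha A != 0 -> acyc K (strand U alpha) #|A|) ->
  exists y, [/\ kdeg dg i.+1 j y, forall A, supports_in U (y A)
    & forall B, kosX y B = z B].
Proof.
move=> hz Uz cz az.
have strz c alpha A : kcomp z c alpha A != 0 -> strand U alpha A.
  rewrite /kcomp /strand /=; case: ifP => [Aa|]; last by rewrite eqxx.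
  exact: Uz.
have lift c alpha : exists g : {set 'I_n} -> K^o,
    (forall A, g A != 0 -> [/\ strand U alpha A, #|A| + i.+1 = n & mdeg alpha + dg c = j]%N)
    /\ forall B, strand U alpha B -> d1 g B = kcomp z c alpha B.
  have [/existsP[A0 nz]|] := boolP [exists A, kcomp z c alpha A != 0]; last first.
    rewrite negb_exists => /forallP z0; exists (fun=> 0); split=> [A|B _].
      by rewrite eqxx.
    by rewrite kos0 //; have := z0 B; rewrite negbK => /eqP.
  have [_ A0i jE] := kdeg_comp hz nz.
  case: (az _ _ _ nz (kcomp z c alpha)) => [A nA|B /andP[Ba _]|g gs gz].
  - by have [_ Ai _] := kdeg_comp hz nA; split; [exact: strz nA|lia].
  - by rewrite -comp_kos // /kcomp Ba cz mxE mcoeff0.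
  by exists g; split=> // A /gs[sA cA]; split=> //; lia.
pose liftP (x : 'I_q * 'X_{1..n < j.+1}) (g : {set 'I_n} -> K^o) :=
    (forall A, g A != 0 ->
      [/\ strand U x.2 A, #|A| + i.+1 = n & mdeg x.2 + dg x.1 = j]%N)
    /\ forall B, strand U x.2 B -> d1 g B = kcomp z x.1 x.2 B.
have [g gP] := fin_all_exists (P := liftP) (fun x => lift x.1 x.2).
(* Components of degree above [j] vanish, so finitely many multidegrees suffice; outside this range
   the lift is zero. *)
pose G (c : 'I_q) alpha A : K^o := if insub alpha is Some a then g (c, a) A else 0.
have GP c alpha : (forall A, G c alpha A != 0 ->
    [/\ strand U alpha A, #|A| + i.+1 = n & mdeg alpha + dg c = j]%N)
    /\ forall B, strand U alpha B -> d1 (G c alpha) B = kcomp z c alpha B.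
  rewrite /G; case: insubP => [a _ <-|big]; first exact: gP (c, a).
  split=> [A|B _]; first by rewrite eqxx.
  rewrite kos0 //; apply/esym/eqP; apply: contraNT big => /(kdeg_comp hz)[_ _ <-].
  by rewrite ltnS leq_addr.
pose y A : 'rV[S]_q := \row_c \sum_(m : 'X_{1..n < j.+1}) G c (m + coind A)%MM A *: 'X_[m].
have yE A c m : (y A 0 c)@_m = G c (m + coind A)%MM A.
  rewrite mxE raddf_sum /=.
  rewrite (eq_bigr (fun k : 'X_{1..n < j.+1} =>
    if (k : 'X_{1..n}) == m then G c (m + coind A)%MM A else 0)) => [|k _]; last first.
    by rewrite mcoeffZ mcoeffX; case: eqP => [->|]; rewrite ?mulr1 ?mulr0.
  case: (ltnP (mdeg m) j.+1) => mj.
    rewrite (bigD1 (BMultinom mj)) //= eqxx big1 ?addr0 // => k.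
    by rewrite -val_eqE /= => /negPf->.
  rewrite big1 => [|k _]; last first.
    by case: eqP => // km; have := bmdeg k; rewrite km ltnNge mj.
  apply/esym/eqP; apply: contraTT mj => /(proj1 (GP _ _))[_ _ <-].
  by rewrite -ltnNge ltnS mdegD; lia.
have compy c alpha : kcomp y c alpha =1 G c alpha.
  move=> A; rewrite /kcomp; case: ifP => [Aa|nAa]; first by rewrite yE submK.
  by apply/esym/eqP; apply: contraFT nAa => /(proj1 (GP _ _))[/andP[]].
exists y; split.
- move=> A c m; rewrite yE => /(proj1 (GP _ _))[_ Ai <-].
  by rewrite mdegD; have := mdeg_coind A; lia.
- by move=> A c m; rewrite yE => /(proj1 (GP _ _))[/andP[_]]; rewrite addmK.
apply: comp_eq => c alpha B Ba; rewrite comp_kos //.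
rewrite (@eq_kos _ _ _ _ _ (G c alpha)) => [|v _]; last by rewrite compy.
have [sB|sB] := boolP (strand U alpha B); first exact: (proj2 (GP _ _)).
rewrite (d1_strand _ Ba sB) => [|A /(proj1 (GP _ _))[]//].
by apply/esym/eqP; apply: contraNT sB; apply: strz.
Qed.

End Lift.

End Koszul.


(** * Koszul exactness: monomial ideals, free modules and dimension shifting *)

Section KoszulExactness.
Variables (n : nat) (K : fieldType).
Local Notation S := {mpoly K[n]}.
Implicit Types (A B : {set 'I_n}) (m alpha : 'X_{1..n}) (i j k : nat).

Notation kosX := (kos (fun v => 'X_v : S)).

(* Vanishing of the [i]-th Koszul homology of [M] in degree [j], that is of
   Tor_i(M, K)_j: homological degree [i] sits on the sets of cardinality [n - i]. *)
Definition kexact q (dg : 'I_q -> nat) (M : 'rV[S]_q -> Prop) i j :=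
  forall z : {set 'I_n} -> 'rV[S]_q, kdeg dg i j z -> (forall A, M (z A)) ->
  (forall B, kosX z B = 0) ->
  exists y, [/\ kdeg dg i.+1 j y, forall A, M (y A) & forall B, kosX y B = z B].

Lemma eq_kexact q (dg : 'I_q -> nat) (M M' : 'rV[S]_q -> Prop) i j :
  (forall v, M v <-> M' v) -> kexact dg M i j -> kexact dg M' i j.
Proof.
move=> MM' kM z hz Mz cz; have [A|y [hy My yz]] := kM z hz _ cz.
  exact/MM'.
by exists y; split=> // A; apply/MM'.
Qed.

(** One direction is [kos_lift]. For the other, a cocycle of a strand becomes a Koszul cycle
    concentrated in multidegree [alpha], and the component of its lift there is the required
    cochain. *)
Lemma kexact_monomial (U : pred {set 'I_n}) i j :
  (forall A B, A \subset B -> U A -> U B) ->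
  kexact (fun _ : 'I_1 => 0%N) (supports_in U) i j <->
  forall alpha k, mdeg alpha = j -> (k + i)%N = n -> acyc K (strand U alpha) k.
Proof.
move=> upU; split=> [kU alpha k aj kn|aU z hz Uz cz]; last first.
  apply: (kos_lift upU hz Uz cz) => c alpha A /(kdeg_comp hz)[_ Ai aj].
  by apply: aU Ai; rewrite -aj addn0.
move=> f fs fc.
pose z A : 'rV[S]_1 := const_mx (f A *: 'X_[alpha - coind A]).
have zE A c m : (z A 0 c)@_m = f A * ((alpha - coind A)%MM == m)%:R.
  by rewrite mxE mcoeffZ mcoeffX.
have fle A : f A != 0 -> (coind A <= alpha)%MM by case/fs=> /andP[].
have compz c beta : kcomp z c beta =1 fun A => if beta == alpha then f A else 0.
  move=> A; rewrite /kcomp zE.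
  have [->|fA] := eqVneq (f A) 0; first by rewrite mul0r !if_same.
  have Aa := fle A fA; case: ifP => [Ab|nAb].
    rewrite -(can_eq (@addmK _ (coind A))) !submK // eq_sym.
    by case: eqP; rewrite ?mulr1 ?mulr0.
  by case: eqP => // bE; rewrite bE Aa in nAb.
have dz B : (coind B <= alpha)%MM -> kos (fun=> 1) f B = 0.
  move=> Ba; have [sB|nB] := boolP (strand U alpha B); first exact: fc.
  by apply: (d1_strand upU _ Ba nB) => A /fs[].
case: (kU z) => [A c m|A c m|B|y [hy Uy yz]].
- rewrite zE mulf_eq0 negb_or => /andP[fA]; case: (eqVneq _ m) => [<- _|]; last by rewrite eqxx.
  have [/andP[Aa _] Ak] := fs A fA; rewrite Ak addn0; split=> //.
  by move: aj; rewrite -{1}(submK Aa) mdegD; have := mdeg_coind A; lia.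
- rewrite zE mulf_eq0 negb_or => /andP[fA]; case: (eqVneq _ m) => [<- _|]; last by rewrite eqxx.
  by have [/andP[_ UA] _] := fs A fA.
- apply: (comp_eq (y := fun=> 0)) => c beta {}B Bb.
  rewrite comp_kos // {2}/kcomp Bb mxE mcoeff0.
  rewrite (@eq_kos _ _ _ _ _ (fun A => if beta == alpha then f A else 0)) => [|v _]; last first.
    by rewrite compz.
  by case: eqP => [bE|_]; [rewrite dz // -bE|rewrite kos0].
exists (kcomp y 0 alpha) => [A nA|B /andP[Ba UB]].
  have [Aa Ai _] := kdeg_comp hy nA; split; last by lia.
  by move: nA; rewrite /kcomp Aa /strand /= Aa; apply: Uy.
rewrite -comp_kos // {1}/kcomp Ba yz -/(kcomp z 0 alpha B).
by have := compz 0 alpha B; rewrite {1}/kcomp Ba eqxx.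
Qed.

(** Over a free module a strand is a cone over any [v] in the support of [alpha]. Only [alpha = 0]
    remains; it sits in homological degree zero and sees just the constant coefficients. *)
Lemma kexact_free q (dg : 'I_q -> nat) i j (z : {set 'I_n} -> 'rV[S]_q) :
  kdeg dg i j z -> (forall B, kosX z B = 0) ->
  (i = 0%N -> forall A c, (z A 0 c)@_0%MM = 0) ->
  exists2 y, kdeg dg i.+1 j y & forall B, kosX y B = z B.
Proof.
move=> hz cz z0; have [|//|c alpha A nA|y [hy _ yz]] :=
  @kos_lift _ _ _ dg predT _ i j z hz _ cz; last by exists y.
  by [].
have [Aa Ai _] := kdeg_comp hz nA.
have [alpha0|alpha_n0] := eqVneq alpha 0%MM; last first.
  have [v av] : exists v, alpha v != 0%N.
    apply/existsP; apply: contraNT alpha_n0; rewrite negb_exists => /forallP a0.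
    by apply/eqP/mnmP=> v; rewrite mnm0E; apply/eqP; have := a0 v; rewrite negbK.
  apply: (@acyc_cone _ _ v) => B; rewrite /strand /= !andbT.
  have cE w : w != v -> coind (v |: B) w = coind (B :\ v) w.
    by move=> wv; rewrite !mnmE !inE (negPf wv).
  apply/mnm_lepP/mnm_lepP=> le w; case: (eqVneq w v) => [->|wv].
  - by rewrite mnmE !inE eqxx lt0n.
  - by rewrite -cE.
  - by rewrite mnmE !inE eqxx.
  - by rewrite cE.
have AT : A = setT.
  apply/setP=> v; rewrite inE; move/mnm_lepP/(_ v): Aa.
  by rewrite alpha0 mnm0E mnmE leqn0 eqb0 negbK.
have i0 : i = 0%N by move: Ai; rewrite AT cardsT card_ord; lia.
move: nA; rewrite /kcomp Aa alpha0.
have -> : (0 - coind A)%MM = 0%MM by apply/mnmP=> v; rewrite mnmBE mnm0E sub0n.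
by rewrite z0 // eqxx.
Qed.

Lemma kdeg_kos q (dg : 'I_q -> nat) i j (y : {set 'I_n} -> 'rV[S]_q) :
  kdeg dg i.+1 j y -> kdeg dg i j (kosX y).
Proof.
move=> hy A c m; rewrite /kos summxE raddf_sum /= => /sum_neq0[v vA].
rewrite mxE -mulrA eps_mpoly mcoeffCM mcoeff_mulX.
case: (eqVneq (m v) 0%N) => [_|mv]; first by rewrite mulr0 eqxx.
rewrite mulf_eq0 negb_or => /andP[_ /hy[Ai <-]].
have mE : (m - U_(v) + U_(v))%MM = m.
  apply: submK; apply/mnm_lepP=> w; rewrite mnm1E; case: eqP => // <-; lia.
have cA := cardsD1 v A; rewrite vA /= in cA; split; first by rewrite cA add1n addSnnS.
by rewrite -{1}mE mdegD mdeg1; lia.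
Qed.

Lemma kos_const0 q (y : {set 'I_n} -> 'rV[S]_q) B c : (kosX y B 0 c)@_0%MM = 0.
Proof.
rewrite /kos summxE raddf_sum big1 //= => v _.
by rewrite mxE -mulrA eps_mpoly mcoeffCM mcoeff_mulX mnm0E eqxx mulr0.
Qed.

Lemma kdegB q (dg : 'I_q -> nat) i j (y z : {set 'I_n} -> 'rV[S]_q) :
  kdeg dg i j y -> kdeg dg i j z -> kdeg dg i j (fun A => y A - z A).
Proof.
move=> hy hz A c m; rewrite !mxE mcoeffB => nz.
have [y0|/hy//] := eqVneq ((y A 0 c)@_m) 0.
by apply: (hz A c); move: nz; rewrite y0 sub0r oppr_eq0.
Qed.

Section Shift.
Variables (p q : nat) (D : 'M[S]_(p, q)) (dgp : 'I_p -> nat) (dgq : 'I_q -> nat).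
Hypothesis D_homog : forall a b m, (D a b)@_m != 0 -> (mdeg m + dgq b = dgp a)%N.
Implicit Types (v w : 'rV[S]_p).

Definition im (v : 'rV[S]_q) : Prop := exists w : 'rV[S]_p, v = w *m D.

Hypothesis ker_const0 : forall w, w *m D = 0 -> forall c, (w 0 c)@_0%MM = 0.

Lemma mul_homog (P : pred nat) w :
  (forall c m, (w 0 c)@_m != 0 -> P (mdeg m + dgp c)%N) ->
  forall c m, ((w *m D) 0 c)@_m != 0 -> P (mdeg m + dgq c)%N.
Proof.
move=> vP b m; rewrite mxE raddf_sum /= => /sum_neq0[a _].
case/mcoeff_mul_neq0=> m1 [m2 [-> /vP Pm1 /D_homog E]].
by rewrite mdegD -addnA E.
Qed.

(** A preimage is cut down to the degrees in [P]; since [D] is homogeneous, the discarded part maps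
    into degrees outside [P], where [v] vanishes. *)
Lemma im_homog (P : pred nat) (v : 'rV[S]_q) : im v ->
  (forall c m, (v 0 c)@_m != 0 -> P (mdeg m + dgq c)%N) ->
  exists2 w, v = w *m D & forall c m, (w 0 c)@_m != 0 -> P (mdeg m + dgp c)%N.
Proof.
move=> [w vE] vP.
pose part Q : 'rV[S]_p := \row_c mpart (fun m => Q (mdeg m + dgp c)%N) (w 0 c).
have partP (Q : pred nat) c m : (part Q 0 c)@_m != 0 -> Q (mdeg m + dgp c)%N.
  by rewrite mxE mcoeff_mpart; case: ifP => //; rewrite eqxx.
exists (part P); last exact: partP.
have wE : w = part P + part (predC P).
  apply/rowP=> c; apply/mpolyP=> m; rewrite !mxE mcoeffD !mcoeff_mpart /=.
  by case: (P _); rewrite ?addr0 ?add0r.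
have vB : v - part P *m D = part (predC P) *m D by rewrite vE {1}wE mulmxDl addrAC subrr add0r.
apply/eqP; rewrite -subr_eq0; apply/eqP/rowP=> c; apply/mpolyP=> m.
rewrite [in RHS]mxE mcoeff0; apply/eqP; apply: contraT => nz.
have nP : predC P (mdeg m + dgq c)%N.
  by apply: (mul_homog (partP _)); rewrite -vB.
case/negP: nP; move: nz; rewrite !mxE mcoeffB.
have [v0|/vP//] := eqVneq ((v 0 c)@_m) 0.
rewrite v0 sub0r oppr_eq0 => nz; apply: (mul_homog (partP P)).
by rewrite mxE.
Qed.

Lemma kdeg_mul i j (y : {set 'I_n} -> 'rV[S]_p) :
  kdeg dgp i j y -> kdeg dgq i j (fun A => y A *m D).
Proof.
move=> hy A c m nz.
have P0 : (fun t => (#|A| + i == n)%N && (t + i == j)%N) (mdeg m + dgq c)%N.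
  apply: (mul_homog (P := fun t => (#|A| + i == n)%N && (t + i == j)%N)) nz => a m' /hy[-> ->].
  by rewrite !eqxx.
by case/andP: P0 => /eqP-> /eqP.
Qed.

Lemma kdeg_lift i j (z : {set 'I_n} -> 'rV[S]_q) :
  kdeg dgq i j z -> (forall A, im (z A)) ->
  exists2 y, kdeg dgp i j y & forall A, z A = y A *m D.
Proof.
move=> hz imz.
pose P A y := z A = y *m D /\ forall c m, (y 0 c)@_m != 0 ->
   (#|A| + i == n)%N && (mdeg m + dgp c + i == j)%N.
have [|y yP] := fin_all_exists (P := P).
  move=> A.
  have [c m|w] := im_homog (P := fun t => (#|A| + i == n)%N && (t + i == j)%N) (imz A).
    by case/hz=> -> ->; rewrite !eqxx.
  by exists w.
exists y => [A c m|A]; last by case: (yP A).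
by case: (yP A) => _ yA /yA/andP[/eqP-> /eqP].
Qed.

Lemma kos_mul (y : {set 'I_n} -> 'rV[S]_p) B :
  kosX (fun A => y A *m D) B = kosX y B *m D.
Proof. by rewrite /kos mulmx_suml; apply: eq_bigr => v _; rewrite scalemxAl. Qed.

(** Dimension shift along [0 -> ker D -> S^p -> im D -> 0]: the free module has Koszul homology only
    from its constants, and [ker_const0] keeps the kernel away from these. *)
Lemma kexact_shift i j :
  kexact dgq im i.+1 j <-> kexact dgp (fun w => w *m D = 0) i j.
Proof.
split=> [kM z hz Mz cz|kM z hz Mz cz].
  have [|y hy yz] := kexact_free hz cz; first by move=> _ A; apply: ker_const0.
  have [||B|u' [hu' Mu' u'y]] := kM (fun A => y A *m D).
  - exact: kdeg_mul.
  - by move=> A; exists (y A).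
  - by rewrite kos_mul yz.
  have [u hu uE] := kdeg_lift hu' Mu'.
  (* Subtracting the boundary of [u] moves [y] into the kernel of [D] without changing its own
     boundary. *)
  exists (fun A => y A - kosX u A); split=> [|A|B].
  - exact/kdegB/kdeg_kos.
  - rewrite mulmxBl -kos_mul -(@eq_kos _ _ _ _ u') => [|v _]; last by rewrite uE.
    by rewrite u'y subrr.
  - by rewrite kosB kos_kos subr0.
have [y hy zE] := kdeg_lift hz Mz.
have [||B|w [hw Mw wy]] := kM (kosX y).
- exact: kdeg_kos.
- move=> A; rewrite -kos_mul -(@eq_kos _ _ _ _ z) => [|v _]; last by rewrite zE.
  exact: cz.
- exact: kos_kos.
have [|//|u hu uy] := kexact_free (kdegB hy hw).
- by move=> B; rewrite kosB wy subrr.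
exists (fun A => u A *m D); split=> [|A|B]; first exact: kdeg_mul.
  by exists (u A).
by rewrite kos_mul uy mulmxBl Mw subr0 zE.
Qed.

(** Graded Nakayama: a generator of the image that is a boundary would yield an element of [ker D]
    with constant coefficient [1]. *)
Lemma kexact0_gens j : kexact dgq im 0 j <-> forall a, dgp a <> j.
Proof.
(* Homological degree zero sits on the full set. *)
pose top q' (v : 'rV[S]_q') A : 'rV[S]_q' := if A == setT then v else 0.
have kos_top q' (v : 'rV[S]_q') B : kosX (top q' v) B = 0.
  apply: kos0 => x xB; rewrite /top; case: eqP => // BT.
  by have := in_setT x; rewrite -BT !inE eqxx.
split=> [kM a aj|ngen z hz Mz cz].
  pose w : 'rV[S]_p := delta_mx 0 a.
  have [A c m|A||y [_ My yz]] := kM (top q (w *m D)); last 1 first.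
  - have [x xy] := fin_all_exists (P := fun A x => y A = x *m D) My.
    have : (w - kosX x setT) *m D = 0.
      rewrite mulmxBl -kos_mul -(@eq_kos _ _ _ _ y) => [|v _]; last by rewrite xy.
      by rewrite yz /top eqxx subrr.
    move/ker_const0/(_ a); rewrite /w !mxE mcoeffB !eqxx kos_const0 subr0.
    by rewrite mcoeff1 eqxx => /eqP; rewrite oner_eq0.
  - rewrite /top; case: (eqVneq A setT) => [->|_]; last by rewrite mxE mcoeff0 eqxx.
    rewrite -rowE mxE => /D_homog; rewrite aj cardsT card_ord !addn0; by [].
  - by rewrite /top; case: ifP => _; [exists w|exists 0; rewrite mul0mx].
  - by move=> B; apply: kos_top.
have [y hy zE] := kdeg_lift hz Mz.
have yT A : y A = top p (y setT) A.
  rewrite /top; case: eqP => [->//|AT]; apply/rowP=> c; apply/mpolyP=> m.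
  rewrite [in RHS]mxE mcoeff0; apply/eqP; apply: contraT => /hy[An _]; case: AT.
  by apply/eqP; rewrite eqEcard subsetT cardsT card_ord -{1}An addn0 leqnn.
have [B|_ A c|u hu uy] := kexact_free hy.
- by rewrite -(kos_top p (y setT) B); apply: eq_kos => v _; rewrite yT.
- apply/eqP; apply: contraT => /hy[_]; rewrite mdeg0 add0n addn0 => /ngen [].
exists (fun A => u A *m D); split=> [|A|B]; first exact: kdeg_mul.
  by exists (u A).
by rewrite kos_mul uy zE.
Qed.

End Shift.

End KoszulExactness.


(** * Koszul homology of an ideal from its minimal free resolution *)

Section Resolution.
Variables (n : nat) (K : fieldType) (I : {mpoly K[n]} -> Prop) (F : min_free_res I).
Local Notation S := {mpoly K[n]}.
Implicit Types (i j k : nat) (W A B : {set 'I_n}).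

Let deg i : 'I_(mfr_rank F i) -> nat := fun a => mfr_deg a.

Lemma mfr_diffP i a b m : (mfr_diff F i a b)@_m != 0 -> (mdeg m + deg b = deg a)%N.
Proof. by rewrite -mcoeff_msupp; apply: mfr_diff_homog. Qed.

Lemma mfr_augP a (b : 'I_1) m : (mfr_aug F a b)@_m != 0 -> (mdeg m + 0 = deg a)%N.
Proof. by rewrite ord1 -mcoeff_msupp addn0; apply: mfr_aug_homog. Qed.

Lemma mfr_im_const0 i (w : 'rV[S]_(mfr_rank F i.+1)) c : ((w *m mfr_diff F i) 0 c)@_0%MM = 0.
Proof.
rewrite mxE raddf_sum big1 //= => a _.
by rewrite mcoeff0M mfr_minimal mulr0.
Qed.

Lemma mfr_ker_const0 i (w : 'rV[S]_(mfr_rank F i.+1)) :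
  w *m mfr_diff F i = 0 -> forall c, (w 0 c)@_0%MM = 0.
Proof. by case/mfr_exactS=> u -> c; apply: mfr_im_const0. Qed.

Lemma mfr_ker_aug_const0 (w : 'rV[S]_(mfr_rank F 0)) :
  w *m mfr_aug F = 0 -> forall c, (w 0 c)@_0%MM = 0.
Proof. by case/mfr_exact0=> u -> c; apply: mfr_im_const0. Qed.

(** The kernel of each differential is the image of the next, so [i] dimension shifts end at the
    generators. The index [t] and its equation avoid a cast between the types
    ['I_(mfr_rank F _)]. *)
Lemma kexact_diff i k t j : t = (k.+1 + i)%N ->
  kexact (@deg k) (im (mfr_diff F k)) i j <-> forall a, @deg t a <> j.
Proof.
elim: i k => [|i IH] k tE.
  rewrite addn0 in tE; rewrite tE.
  exact: kexact0_gens (@mfr_diffP k) (@mfr_ker_const0 k) j.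
apply: iff_trans (kexact_shift (@mfr_diffP k) (@mfr_ker_const0 k) i j) _.
apply: iff_trans (IH k.+1 _); last by rewrite tE addnS.
by split; apply: eq_kexact => v; [|apply: iff_sym]; apply: mfr_exactS.
Qed.

Lemma kexact_res i j :
  kexact (fun _ : 'I_1 => 0%N) (im (mfr_aug F)) i j <->
  forall a : 'I_(mfr_rank F i), mfr_deg a <> j.
Proof.
case: i => [|i]; first exact: kexact0_gens mfr_augP mfr_ker_aug_const0 j.
apply: iff_trans (kexact_shift mfr_augP mfr_ker_aug_const0 i j) _.
apply: iff_trans (@kexact_diff i 0 i.+1 j erefl).
by split; apply: eq_kexact => v; [|apply: iff_sym]; apply: mfr_exact0.
Qed.

End Resolution.

(** * Hochster's formula and the regularity bounds *)

Section Hochster.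
Variables (n : nat) (K : fieldType) (U : pred {set 'I_n}).
Hypothesis upU : forall A B : {set 'I_n}, A \subset B -> U A -> U B.
Implicit Types (i j k : nat) (W A B : {set 'I_n}) (alpha : 'X_{1..n}).

Definition upper W : pred {set 'I_n} := [pred A : {set 'I_n} | (A \subset W) && U A].

Lemma upper_convex W : convex (upper W).
Proof.
move=> A B C AB BC /andP[_ UA] /andP[CW _].
by rewrite /upper /= (subset_trans BC CW) (upU AB UA).
Qed.

Definition char_mnm W : 'X_{1..n} := [multinom (v \in W : nat) | v < n].

Lemma supp_char W : supp (char_mnm W) = W.
Proof. by apply/setP=> v; rewrite inE mnmE; case: (v \in W). Qed.

Lemma mdeg_char W : mdeg (char_mnm W) = #|W|.
Proof. by rewrite mdegE; under eq_bigr do rewrite mnmE; rewrite -big_mkcond sum1_card. Qed.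

Lemma char_supp alpha : (forall v, alpha v <= 1)%N -> char_mnm (supp alpha) = alpha.
Proof. by move=> a1; apply/mnmP=> v; rewrite mnmE inE; have := a1 v; case: (alpha v) => [|[]]. Qed.

Lemma strand_char W :
  strand U (char_mnm W) =1 [pred A : {set 'I_n} | (~: W \subset A) && upper W (A :\: ~: W)].
Proof.
move=> A; rewrite /strand /upper /= setDE setCK subsetIr /=.
congr (_ && U _).
  apply/mnm_lepP/subsetP=> [le v|WA v]; last first.
    by have := WA v; rewrite !mnmE inE; case: (v \in W); case: (v \in A) => // /(_ isT).
  by have := le v; rewrite !mnmE inE; case: (v \in W); case: (v \in A).
by apply/setP=> v; rewrite !inE mnmBE !mnmE; case: (v \in W); case: (v \in A).
Qed.

(** For [alpha v >= 2] the strand conditions do not depend on whether [v] lies in [A], so the strand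
    is a cone. *)
Lemma strand_nonsqfree alpha v k : (1 < alpha v)%N -> acyc K (strand U alpha) k.
Proof.
move=> av; apply: (@acyc_cone _ _ v) => A.
have cE w : w != v -> coind (v |: A) w = coind (A :\ v) w.
  by move=> wv; rewrite !mnmE !inE (negPf wv).
have c1 B : (coind B v <= 1)%N by rewrite mnmE; case: (v \in B).
rewrite /strand /=; congr (_ && U _).
  apply/mnm_lepP/mnm_lepP=> le w; case: (eqVneq w v) => [->|wv].
  - by apply: leq_trans (c1 _) _; lia.
  - by rewrite -cE.
  - by apply: leq_trans (c1 _) _; lia.
  - by rewrite cE.
apply/setP=> w; rewrite !inE !mnmBE; case: (eqVneq w v) => [->|wv]; last by rewrite cE.
by have := c1 (v |: A); have := c1 (A :\ v); lia.
Qed.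

(* [upper U W] carries the cohomology of the simplex on [W] relative to the
   restriction to [W] of the Stanley-Reisner complex. *)
Lemma hochster (I : {mpoly K[n]} -> Prop) (F : min_free_res I) i j :
  (forall p, I p <-> forall m, p@_m != 0 -> U (supp m)) ->
  (forall a : 'I_(mfr_rank F i), mfr_deg a <> j) <->
  forall W k, #|W| = j -> (k + i = j)%N -> acyc K (upper W) k.
Proof.
move=> IU; apply: iff_trans (iff_sym (kexact_res F i j)) _.
have imE (v : 'rV_1) : im (mfr_aug F) v <-> supports_in U v.
  have vE : v = (v 0 0)%:M by rewrite {1}(mx11_scalar v).
  split=> [[w wE] c m|H].
    rewrite ord1; apply: (proj1 (IU _)); apply/(mfr_aug_image F).
    by exists w; rewrite -wE -vE.
  by have /IU/(mfr_aug_image F)[w wE] := H 0; exists w; rewrite vE wE.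
have kE : kexact (fun _ : 'I_1 => 0%N) (im (mfr_aug F)) i j <->
    kexact (fun _ : 'I_1 => 0%N) (@supports_in n K 1 U) i j.
  by split; [exact: (eq_kexact imE)|exact: (eq_kexact (fun v => iff_sym (imE v)))].
apply: iff_trans kE _; apply: iff_trans (kexact_monomial K i j upU) _.
(* All members of a squarefree strand contain [~: W]; taking it away lowers the degree by its
   size. *)
have shift W k : acyc K (strand U (char_mnm W)) (#|~: W| + k) <-> acyc K (upper W) k.
  have dW A : upper W A -> [disjoint A & ~: W].
    by case/andP=> AW _; rewrite disjoints_subset setCK.
  apply: iff_trans (acyc_shift K k (@upper_convex W) dW).
  by split; apply: eq_acyc => A; rewrite strand_char.
have cW W : (#|W| + #|~: W| = n)%N by rewrite cardsC card_ord.
split=> [aU W k Wj kj|aU alpha k aj kn].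
  by apply/shift/aU; [rewrite mdeg_char|rewrite -addnA kj -Wj addnC cW].
have [/existsP[v av]|] := boolP [exists v, 1 < alpha v]%N.
  exact: strand_nonsqfree av.
rewrite negb_exists => /forallP a1.
have aE : alpha = char_mnm (supp alpha) by rewrite char_supp // => v; rewrite leqNgt.
set W := supp alpha in aE; rewrite aE mdeg_char in aj *.
have [Wk|kW] := leqP #|~: W| k.
  rewrite -(subnKC Wk); apply/shift/aU => //.
  by have := cW W; lia.
apply: acyc_nocard => A; rewrite strand_char => /andP[/subset_leq_card WA _].
by rewrite neq_ltn (leq_trans kW WA) orbT.
Qed.

Lemma subsets_acyc W k : (0 < k)%N -> acyc K [pred A : {set 'I_n} | A \subset W] k.
Proof.
move=> k0; case: (set_0Vmem W) => [->|[v vW]].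
  by apply: acyc_nocard => A /=; rewrite subset0 => /eqP->; rewrite cards0 eq_sym -lt0n.
apply: (@acyc_cone _ _ v) => A; rewrite /= subUset sub1set vW /=.
apply/subsetP/subsetP=> AW w; first by rewrite !inE => /andP[_ /AW].
by case: (eqVneq w v) => [->//|wv wA]; apply: AW; rewrite !inE wv.
Qed.

(** The sequence of the pair, with the full simplex on [W] acyclic in positive degrees; in degree
    zero it is not when [W] is empty. *)
Lemma lower_acycP W k : (0 < k)%N ->
  acyc K (upper W) k.+1 <-> acyc K [pred A : {set 'I_n} | (A \subset W) && ~~ U A] k.
Proof.
move=> k0; pose P := [pred A : {set 'I_n} | A \subset W].
have cP : convex P by move=> A B C _ BC _; apply: subset_trans.
have upQ A B : A \subset B -> P A -> P B -> U A -> U B by move=> AB _ _; apply: upU.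
by split=> a; [apply: (acyc_quot cP upQ)|apply: (acyc_sub cP upQ)] => //;
  apply: subsets_acyc.
Qed.

Lemma reg_le (I : {mpoly K[n]} -> Prop) (r : int) b :
  (forall p, I p <-> forall m, p@_m != 0 -> U (supp m)) ->
  (forall W k, (b < k)%N -> acyc K (upper W) k) -> is_reg I r -> r <= b%:Z.
Proof.
move=> IU ab [beta [[F betaE] [i [j [nz <-]]] _]].
rewrite leNgt; apply/negP=> bij; case: nz.
rewrite betaE; apply/eqP; rewrite cards_eq0; apply/eqP/setP=> a; rewrite !inE.
apply/eqP; move: a; apply/(hochster F i j IU) => W k _ kj; apply: ab; lia.
Qed.

(** [W] is seen by the Betti number at [j = #|W|] and [i = #|W| - k], which vanishes because
    [j - i = k] exceeds [r]. *)
Lemma reg_acyc (I : {mpoly K[n]} -> Prop) (r : int) W k :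
  (forall p, I p <-> forall m, p@_m != 0 -> U (supp m)) ->
  is_reg I r -> r < k%:Z -> acyc K (upper W) k.
Proof.
move=> IU [beta [[F betaE] _ rmax]] rk.
have [kW|Wk] := leqP k #|W|; last first.
  apply: acyc_nocard => A /andP[/subset_leq_card AW _].
  by rewrite neq_ltn (leq_ltn_trans AW Wk).
apply: (proj1 (hochster F (#|W| - k) #|W| IU)) => //; last by rewrite subnKC.
move=> a aW; have /rmax : beta (#|W| - k)%N #|W| <> 0%N; last by lia.
rewrite betaE => /eqP; rewrite cards_eq0 => /eqP/setP/(_ a).
by rewrite !inE aW eqxx.
Qed.

End Hochster.


(** * Monomial ideals *)

Section MonomialIdeals.
Variables (n : nat) (K : fieldType).
Local Notation S := {mpoly K[n]}.
Implicit Types (m : 'X_{1..n}) (p : S) (A B C : {set 'I_n}) (G : S -> Prop).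

Lemma ideal_gen_supp (U : pred 'X_{1..n}) G p :
  (forall m1 m2, U m2 -> U (m1 + m2)%MM) ->
  (forall g, G g -> forall m, g@_m != 0 -> U m) ->
  ideal_gen G p -> forall m, p@_m != 0 -> U m.
Proof.
move=> upU GU [k [a [g [Gg ->]]]] m; rewrite raddf_sum => /sum_neq0[i _].
by case/mcoeff_mul_neq0=> m1 [m2 [-> _ /(GU _ (Gg i))]]; apply: upU.
Qed.

(** Together with [ideal_gen_supp], this tests membership in a monomial ideal one monomial at a
    time. *)
Lemma ideal_gen_mono G p :
  (forall m, p@_m != 0 -> exists a g, G g /\ 'X_[m] = a * g) -> ideal_gen G p.
Proof.
move=> pG; pose s := msupp p.
have sG (i : 'I_(size s)) : exists x : S * S, G x.2 /\ 'X_[nth 0%MM s i] = x.1 * x.2.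
  have [|a [g [Gg E]]] := pG (nth 0%MM s i); last by exists (a, g).
  by rewrite -mcoeff_msupp mem_nth.
have [x xP] := fin_all_exists sG.
exists (size s), (fun i : 'I_(size s) => p@_(nth 0%MM s i) *: (x i).1), (fun i => (x i).2).
split=> [i|]; first by case: (xP i).
rewrite {1}[p]mpolyE -/s (big_nth 0%MM) big_mkord; apply: eq_bigr => i _.
by case: (xP i) => _ ->; rewrite scalerAl.
Qed.

Lemma mcoeffX_neq0 m m' : ('X_[m] : S)@_m' != 0 -> m' = m.
Proof. by rewrite mcoeffX; case: (eqVneq m m') => [->//|_]; rewrite eqxx. Qed.

Lemma mcoeffX_self m : ('X_[m] : S)@_m != 0.
Proof. by rewrite mcoeffX eqxx oner_eq0. Qed.

Lemma mpolyX_factor m m' : (m' <= m)%MM -> 'X_[m] = 'X_[m - m'] * 'X_[m'] :> S.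
Proof. by move=> le; rewrite -mpolyXD submK. Qed.

Lemma lemU v m : (U_(v) <= m)%MM = (m v != 0%N).
Proof.
apply/mnm_lepP/idP=> [/(_ v)|mv w]; rewrite mnm1E ?eqxx ?lt0n //.
by case: eqP => // <-; rewrite lt0n.
Qed.

Lemma edge_idealP (e : rel 'I_n) p : irreflexive e ->
  edge_ideal K e p <-> forall m, p@_m != 0 -> ~~ indep e (supp m).
Proof.
move=> e_irr; split.
  apply: (@ideal_gen_supp (fun m => ~~ indep e (supp m))) => [m1 m2|g [x [y [xy ->]]] m].
    apply: contra; apply: indepS; apply/subsetP=> v; rewrite !inE mnmDE; lia.
  rewrite -mpolyXD => /mcoeffX_neq0->; apply/negP=> /indepP/(_ x y).
  by rewrite !inE !mnmDE !mnm1E !eqxx xy addn1 => /(_ isT isT).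
move=> pE; apply: ideal_gen_mono => m /pE; rewrite negb_forall_in.
case/existsP=> x /andP[xm]; rewrite negb_forall_in => /existsP[y /andP[ym]].
rewrite negbK => xy; have xy' : x != y by apply: contraTneq xy => ->; rewrite e_irr.
exists 'X_[m - (U_(x) + U_(y))], ('X_x * 'X_y); split; first by exists x, y.
rewrite -mpolyXD; apply: mpolyX_factor; apply/mnm_lepP=> w; rewrite mnmDE !mnm1E.
rewrite !inE in xm ym.
case: (eqVneq x w) => [<-|_]; first by rewrite eq_sym (negPf xy') addn0 lt0n.
by case: (eqVneq y w) => [<-|_] //; rewrite add0n lt0n.
Qed.

Definition degC C m := (\sum_(v in C) m v)%N.

Lemma degCD C m1 m2 : degC C (m1 + m2)%MM = (degC C m1 + degC C m2)%N.
Proof. by rewrite -big_split; apply: eq_bigr => v _; rewrite mnmDE. Qed.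

Lemma degC_char C A : degC C (char_mnm A) = #|A :&: C|.
Proof.
rewrite /degC; under eq_bigr do rewrite mnmE.
rewrite -big_mkcondr /= sum1_card; apply: eq_card => v.
by rewrite !inE andbC.
Qed.

Lemma var_ideal_degC C p : var_ideal C p -> forall m, p@_m != 0 -> (0 < degC C m)%N.
Proof.
apply: (@ideal_gen_supp (fun m => 0 < degC C m)%N) => [m1 m2|g [v vC ->] m].
  by rewrite degCD => /ltn_addl; apply.
move/mcoeffX_neq0->; rewrite /degC (bigD1 v) //= mnm1E eqxx; lia.
Qed.

Lemma ideal_pow_degC C s p : ideal_pow (var_ideal C) s p ->
  forall m, p@_m != 0 -> (s <= degC C m)%N.
Proof.
apply: (@ideal_gen_supp (fun m => s <= degC C m)%N) => [m1 m2|_ [g [gC ->]]].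
  by rewrite degCD => le; apply: leq_trans le (leq_addl _ _).
elim: s g gC => // s IH g gC m; rewrite big_ord_recl.
case/mcoeff_mul_neq0=> m1 [m2 [-> /(var_ideal_degC (gC _)) m1C]].
move/(IH (fun i => g (lift ord0 i)) (fun i => gC _)) => m2C.
by rewrite degCD -add1n leq_add.
Qed.

Lemma var_ideal_char C B : var_ideal C ('X_[char_mnm B] : S) <-> ~~ [disjoint B & C].
Proof.
split=> [/var_ideal_degC/(_ _ (mcoeffX_self _))|].
  by rewrite degC_char card_gt0 setI_eq0.
rewrite -setI_eq0 => /set0Pn[v /setIP[vB vC]].
apply: ideal_gen_mono => m /mcoeffX_neq0->.
exists 'X_[char_mnm B - U_(v)], 'X_v; split; first by exists v.
by apply: mpolyX_factor; rewrite lemU mnmE vB.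
Qed.

Lemma ideal_pow_char C s A :
  ideal_pow (var_ideal C) s ('X_[char_mnm A] : S) <-> (s <= #|A :&: C|)%N.
Proof.
split=> [/ideal_pow_degC/(_ _ (mcoeffX_self _))|sA]; first by rewrite degC_char.
have [D DAC cD] : exists2 D : {set 'I_n}, D \subset A :&: C & #|D| = s.
  have [t [ut <- tAC]] := card_geqP sA; exists [set v in t].
    by apply/subsetP=> v; rewrite inE => /tAC.
  by rewrite cardsE (card_uniqP ut).
apply: ideal_gen_mono => m /mcoeffX_neq0->.
exists 'X_[char_mnm A - char_mnm D], 'X_[char_mnm D]; split; last first.
  apply: mpolyX_factor; apply/mnm_lepP=> v; rewrite !mnmE.
  case: (boolP (v \in D)) => // /(subsetP DAC); rewrite inE => /andP[->].
  by [].
subst s; exists (fun i => 'X_(enum_val i)); split=> [i|].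
  have := subsetP DAC _ (enum_valP i); rewrite inE => /andP[_ iC].
  apply: ideal_gen_mono => m' /mcoeffX_neq0->.
  by exists 1, 'X_(enum_val i); rewrite mul1r; split=> //; exists (enum_val i).
rewrite -(big_enum_val (fun v => 'X_v : S)) mpolyXE_id [RHS]big_mkcond.
by apply: eq_bigr => v _; rewrite mnmE; case: ifP.
Qed.

(** * The third symbolic power of an edge ideal *)

Section SymbolicPower.
Variable e : rel 'I_n.
Hypothesis e_irr : irreflexive e.

(** The decomposition is tested on the squarefree monomial of [B], which lies outside [var_ideal C]
    exactly when [B] misses [C]. *)
Lemma decomp_indep (P : {set {set 'I_n}}) B : irredundant_decomp (edge_ideal K e) P ->
  indep e B = [exists C in P, [disjoint B & C]].
Proof.
case=> IP _; rewrite -[LHS]negbK -[RHS]negbK; congr (~~ _).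
rewrite negb_exists_in; apply/idP/forall_inP=> [nB C CP|PB].
  apply/(var_ideal_char C B); apply: (proj1 (IP _)) CP.
  by apply/edge_idealP => // m /mcoeffX_neq0->; rewrite supp_char.
have : edge_ideal K e 'X_[char_mnm B] by apply/IP => C /PB/var_ideal_char.
by move/(edge_idealP _ e_irr)/(_ _ (mcoeffX_self _)); rewrite supp_char.
Qed.

(** Removing [D] makes [A] miss [C] exactly when [D] contains [A :&: C], so the best choice is
    [D = A :&: C]. *)
Lemma decomp_near_indep (P : {set {set 'I_n}}) A :
  irredundant_decomp (edge_ideal K e) P ->
  near_indep e A = [exists C in P, #|A :&: C| <= 2]%N.
Proof.
move=> dP; apply/existsP/exists_inP=> [[D /and3P[DA D2]]|[C CP AC2]].
  rewrite (decomp_indep _ dP) => /exists_inP[C CP dC]; exists C => //.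
  apply: leq_trans D2; apply: subset_leq_card; apply/subsetP=> v /setIP[vA vC].
  by have := disjointFl dC vC; rewrite inE vA andbT => /negbFE.
exists (A :&: C); rewrite subsetIl AC2 (decomp_indep _ dP) /=.
apply/exists_inP; exists C => //; rewrite -setI_eq0; apply/eqP/setP=> v.
by rewrite !inE; case: (v \in A); case: (v \in C).
Qed.

(** The condition on [A] makes no reference to a decomposition, so the one hidden in
    [symbolic_power] may differ from [P]. *)
Lemma symbolic_power_char (P : {set {set 'I_n}}) A :
  irredundant_decomp (edge_ideal K e) P ->
  symbolic_power (edge_ideal K e) 3 ('X_[char_mnm A] : S) <-> ~~ near_indep e A.
Proof.
move=> dP; split=> [[Q dQ QA]|nA]; last exists P => // C CP.
  rewrite (decomp_near_indep _ dQ) negb_exists_in; apply/forall_inP=> C /QA.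
  by move/ideal_pow_char; rewrite -ltnNge.
apply/ideal_pow_char; rewrite ltnNge; apply: contra nA => AC.
by rewrite (decomp_near_indep _ dP); apply/exists_inP; exists C.
Qed.

Lemma squarefree_partP (P : {set {set 'I_n}}) p :
  irredundant_decomp (edge_ideal K e) P ->
  squarefree_part (symbolic_power (edge_ideal K e) 3) p <->
  forall m, p@_m != 0 -> ~~ near_indep e (supp m).
Proof.
move=> dP; split.
  apply: (@ideal_gen_supp (fun m => ~~ near_indep e (supp m))) => [m1 m2|g [m' [m1 Jm ->]] m].
    apply: contra; apply: near_indepS; apply/subsetP=> v; rewrite !inE mnmDE; lia.
  by move/mcoeffX_neq0->; apply/(symbolic_power_char _ dP); rewrite char_supp.
move=> pU; apply: ideal_gen_mono => m /pU Um.
exists 'X_[m - char_mnm (supp m)], 'X_[char_mnm (supp m)]; split.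
  exists (char_mnm (supp m)); split=> // [v|]; first by rewrite mnmE leq_b1.
  exact/(symbolic_power_char _ dP).
apply: mpolyX_factor; apply/mnm_lepP=> v; rewrite mnmE inE.
by case: eqP => //= /eqP; rewrite lt0n.
Qed.

Lemma squarefree_part_nodecomp p :
  (forall P, ~ irredundant_decomp (edge_ideal K e) P) ->
  squarefree_part (symbolic_power (edge_ideal K e) 3) p <->
  forall m, p@_m != 0 -> false.
Proof.
move=> noP; split; last by move=> p0; apply: ideal_gen_mono => m /p0.
by apply: (@ideal_gen_supp pred0) => // g [m [_ [P /noP]]].
Qed.

Lemma reg_squarefree_part (r3 : int) b : (0 < b)%N ->
  (forall W k, (b <= k)%N -> acyc K (near_faces e W) k) ->
  is_reg (squarefree_part (symbolic_power (edge_ideal K e) 3)) r3 -> r3 <= b%:Z.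
Proof.
move=> b0 ab reg3; rewrite leNgt; apply/negP=> br.
(* Once the bound is assumed to fail, a decomposition is refuted, as it would imply the bound. What
   is left is the zero ideal, handled by [reg_le] with [pred0]. *)
have noP P : ~ irredundant_decomp (edge_ideal K e) P.
  move=> dP; have upU A B : A \subset B -> ~~ near_indep e A -> ~~ near_indep e B.
    by move=> AB; apply: contra; apply: near_indepS.
  move: br; rewrite ltNge => /negP; apply.
  apply: (reg_le upU (fun p => squarefree_partP p dP) _ reg3) => W [|k] // bk.
  (* Degree [k.+1] of the upper family is degree [k] of the near faces: vanishing from [b] on gives
     regularity at most [b]. *)
  apply/(lower_acycP K upU W (leq_trans b0 bk)).
  by apply: eq_acyc (ab W k bk) => A; rewrite /near_faces /= negbK.
have : r3 <= b%:Z; last by rewrite leNgt br.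
apply: (@reg_le _ _ pred0 _ _ _ _ _ _ reg3) => // [p|W k _].
  exact: squarefree_part_nodecomp.
by apply: acyc_nocard => A; rewrite /upper /= andbF.
Qed.

Lemma nonindep_up A B : A \subset B -> ~~ indep e A -> ~~ indep e B.
Proof. by move=> AB; apply: contra; apply: indepS. Qed.

Lemma card_nonindep A : ~~ indep e A -> (1 < #|A|)%N.
Proof.
apply: contraR; rewrite -leqNgt => /card_le1_eqP A1; apply/indepP=> x y xA yA.
by rewrite (A1 x y xA yA) e_irr.
Qed.

(** Dependent sets have at least two elements, so the families in Hochster's formula are empty in
    degrees below two. In particular [absz r] is [r]. *)
Lemma reg_edge_ideal_ge2 (r : int) : is_reg (edge_ideal K e) r -> 2 <= r.
Proof.
move=> rege; rewrite leNgt; apply/negP=> r2.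
case: rege => beta [[F betaE] [i [j [nz rE]]] _]; case: nz.
rewrite betaE; apply/eqP; rewrite cards_eq0; apply/eqP/setP=> a; rewrite !inE.
apply/eqP; move: a; apply/(hochster nonindep_up F i j (fun p => edge_idealP p e_irr)).
move=> W k _ kj; apply: acyc_nocard => A /andP[_ /card_nonindep A2].
by rewrite neq_ltn (leq_trans _ A2) ?orbT //; lia.
Qed.

Lemma reg_edge_ideal (r : int) W k : is_reg (edge_ideal K e) r -> (absz r <= k)%N ->
  acyc K (Ind e W) k.
Proof.
move=> rege rk; have r2 := reg_edge_ideal_ge2 rege.
have k0 : (0 < k)%N by lia.
have /(lower_acycP K nonindep_up W k0) : acyc K (upper (fun A => ~~ indep e A) W) k.+1.
  have IU p := edge_idealP p e_irr.
  apply: (@reg_acyc _ _ (fun A => ~~ indep e A) nonindep_up _ r W k.+1 IU rege); lia.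
by apply: eq_acyc => A; rewrite /Ind /= negbK.
Qed.

End SymbolicPower.

End MonomialIdeals.

Theorem theorem7p6 (K : fieldType) (n : nat) (e : rel 'I_n)
  (e_sym : ssrbool.symmetric e) (e_irr : irreflexive e)
  (htI : height_geq (edge_ideal K e) 3)
  (r r3 : int)
  (regI : is_reg (edge_ideal K e) r)
  (regI3 : is_reg (squarefree_part (symbolic_power (edge_ideal K e) 3)) r3) :
  r3 <= Num.min ((n %/ 2)%N%:Z + 3) (r + 4).
Proof.
rewrite le_min; apply/andP; split.
  have : r3 <= ((n %/ 2) + 3)%N%:Z; last by rewrite PoszD.
  apply: (reg_squarefree_part e_irr _ _ regI3) => [|W k bk]; first by rewrite addn3.
  exact: near_faces_half.
have r2 := reg_edge_ideal_ge2 e_irr regI.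
have : r3 <= (absz r + 4)%N%:Z; last by lia.
apply: (reg_squarefree_part e_irr _ _ regI3) => [|W k bk]; first by rewrite addn4.
apply: near_faces_reg bk => // Z i ri.
exact: reg_edge_ideal regI ri.
Qed.
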